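(* Consider the reduced system (in $\mathbb{R}^3$) $$\dot y_1=\beta y_1+\xi y_1^3+\eta y_1y_2^2+\eta y_1y_3^2+\tau y_2y_3,$$ $$\dot y_2=\beta y_2+\xi y_2^3+\eta y_2y_3^2+\eta y_1^2y_2+\tau y_1y_3,$$ $$\dot y_3=\beta y_3+\xi y_3^3+\eta y_1^2y_3+\eta y_2^2y_3+\tau y_1y_2,$$ with coefficients $\beta,\xi,\eta,\tau$ as in the context, where $\gamma_2<0$ (so $\tau>0$). Consider its roll solutions $$\pm p_1=\left(\pm\sqrt{\tfrac{-\beta}{\xi}},0,0\right),\quad \pm p_2=\left(0,\pm\sqrt{\tfrac{-\beta}{\xi}},0\right),\quad \pm p_3=\left(0,0,\pm\sqrt{\tfrac{-\beta}{\xi}}\right),$$ and assume $\beta>0$ (equivalently $\lambda>\lambda_0$), so that $\xi<0$ for these solutions to exist. 1) If $\eta<\xi-\tau\sqrt{\frac{-\xi}{\beta}}$, then the roll solutions all have three stable eigenvalues. Namely, all rolls are local attractors. 2) If $\xi-\tau\sqrt{\frac{-\xi}{\beta}}<\eta<\xi+\tau\sqrt{\frac{-\xi}{\beta}}$, then the roll solutions all have two stable eigenvalues and one unstable eigenvalue. Moreover, the unstable directions for $\pm p_1$ are $(0,\pm1,1)$, for $\pm p_2$ are $(\pm1,0,1)$, and for $\pm p_3$ are $(\pm1,1,0)$. Namely, all rolls are saddles with two-dimensional stable manifolds and one-dimensional unstable manifolds. 3) If $\eta>\xi+\tau\sqrt{\frac{-\xi}{\beta}}$, then the roll solutions all have one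 stable eigenvalue and two unstable eigenvalues. Namely, all rolls are saddles with one-dimensional stable manifolds and two-dimensional unstable manifolds.
   Context: Origin and coefficients. The reduced system is the leading-order center manifold reduction (higher-order terms omitted), near $(u,\lambda)=(0,\lambda_0)$, of the Cahn--Hilliard equation $u_t=-\Delta^2u-\lambda\Delta u+\Delta(\gamma_2u^2+\gamma_3u^3)$ for real-valued functions $u$ on $\mathbb{R}^2$ that are periodic with respect to a lattice $L$, even in $x$, and of zero mean on a period cell; $\lambda,\gamma_2\in\mathbb{R}$ and $\gamma_3>0$. Here the nonzero vectors of minimal length in the dual lattice $L^*$ (vectors $k$ with $k\cdot l\in2\pi\mathbb{Z}$ for all $l\in L$) are exactly $\pm k_1^c,\pm k_2^c,\pm k_3^c$ with $k_3^c=k_1^c+k_2^c$; $\lambda_0=|k_1^c|^2=|k_2^c|^2=|k_3^c|^2$; and $u\approx y_1\cos(k_1^c\cdot x)+y_2\cos(k_2^c\cdot x)+y_3\cos(k_3^c\cdot x)$. The coefficients are $$\beta=-|k_1^c|^2(|k_1^c|^2-\lambda),\qquad \xi=-\tfrac34|k_1^c|^2\gamma_3+\tfrac16\gamma_2^2,$$ $$\eta=-\tfrac32|k_1^c|^2\gamma_3+\frac{|k_1^c|^2}{|k_1^c-k_2^c|^2-|k_1^c|^2}\gamma_2^2,\qquad \tau=-|k_1^c|^2\gamma_2 .$$ ''Eigenvalues'' of a solution means eigenvalues of the Jacobian matrix of the reduced system at that equilibrium; an eigenvalue is stable if it is negative and unstable if it is positive; unstable directions are eigenvectors for unstable eigenvalues.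 In item 2, the sign in the unstable direction agrees with the sign of the roll solution $\pm p_j$. *)

(* Defs.v *)
From HB Require Import structures.
From mathcomp Require Import all_boot all_order all_algebra.
From mathcomp Require Import all_classical all_reals all_analysis.

Set Implicit Arguments.
Unset Strict Implicit.
Unset Printing Implicit Defensive.

Import Order.TTheory GRing.Theory Num.Theory.
Import numFieldNormedType.Exports.

Local Open Scope classical_set_scope.
Local Open Scope ring_scope.

(* The norm `|u| of the library on row vectors is the sup norm, so Euclidean
   lengths are expressed through this inner product. *)
Definition dot (R : realType) (n : nat) (u v : 'rV[R]_n) : R := (u *m v^T) 0 0.

Definition normsq (R : realType) (n : nat) (u : 'rV[R]_n) : R := dot u u.

(* The lattice spanned over the integers by the rows of B. *)
Definition lattice (R : realType) (n : nat) (B : 'M[R]_n) : set 'rV[R]_n :=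
  [set l | exists z : 'rV[int]_n, l = map_mx intr z *m B].

Definition dual_lattice (R : realType) (n : nat) (L : set 'rV[R]_n) :
    set 'rV[R]_n :=
  [set k | forall l, L l -> exists m : int, dot k l = 2 * pi * m%:~R].

Definition minimal_vectors (R : realType) (n : nat) (L : set 'rV[R]_n) :
    set 'rV[R]_n :=
  [set k | [/\ L k, k != 0 &
     forall k', L k' -> k' != 0 -> normsq k <= normsq k']].

Definition coef_beta (R : realType) (k1 : 'rV[R]_2) (lambda : R) : R :=
  - normsq k1 * (normsq k1 - lambda).

Definition coef_xi (R : realType) (k1 : 'rV[R]_2) (gamma2 gamma3 : R) : R :=
  - (3 / 4) * normsq k1 * gamma3 + 1 / 6 * gamma2 ^+ 2.

Definition coef_eta (R : realType) (k1 k2 : 'rV[R]_2) (gamma2 gamma3 : R) : R :=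
  - (3 / 2) * normsq k1 * gamma3
  + normsq k1 / (normsq (k1 - k2) - normsq k1) * gamma2 ^+ 2.

Definition coef_tau (R : realType) (k1 : 'rV[R]_2) (gamma2 : R) : R :=
  - normsq k1 * gamma2.

Definition row3 (R : realType) (a b c : R) : 'rV[R]_3 :=
  \row_(i < 3) nth 0 [:: a; b; c] i.

Definition reduced_field (R : realType) (beta xi eta tau : R)
    (y : 'rV[R]_3) : 'rV[R]_3 :=
  let y1 := y 0 0 in let y2 := y 0 1 in let y3 := y 0 2 in
  row3
    (beta * y1 + xi * y1 ^+ 3 + eta * y1 * y2 ^+ 2 + eta * y1 * y3 ^+ 2
     + tau * y2 * y3)
    (beta * y2 + xi * y2 ^+ 3 + eta * y2 * y3 ^+ 2 + eta * y1 ^+ 2 * y2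
     + tau * y1 * y3)
    (beta * y3 + xi * y3 ^+ 3 + eta * y1 ^+ 2 * y3 + eta * y2 ^+ 2 * y3
     + tau * y1 * y2).

(* (-1) ^+ s is the sign of the roll; j = 0, 1, 2 stands for p_1, p_2, p_3. *)
Definition roll (R : realType) (beta xi : R) (s : bool) (j : 'I_3) : 'rV[R]_3 :=
  let r := (-1) ^+ s * Num.sqrt (- beta / xi) in
  nth 0 [:: row3 r 0 0; row3 0 r 0; row3 0 0 r] j.

Definition roll_direction (R : realType) (s : bool) (j : 'I_3) : 'rV[R]_3 :=
  let e := (-1) ^+ s in
  nth 0 [:: row3 0 e 1; row3 e 0 1; row3 e 1 0] j.

(* Eigenvalues are counted with algebraic multiplicity.  The characteristic
   polynomial is required to split over R, so that no eigenvalue is omitted. *)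
Definition eigenvalue_counts (R : realType) (n : nat)
    (F : 'rV[R]_n -> 'rV[R]_n) (p : 'rV[R]_n) (nstable nunstable : nat) : Prop :=
  exists s : seq R,
    [/\ char_poly ('J F p) = \prod_(l <- s) ('X - l%:P),
        count (fun l => l < 0) s = nstable &
        count (fun l => 0 < l) s = nunstable].

(* 'J F p acts on row vectors from the right ('d F p v = v *m 'J F p), so it is
   the transpose of the column-vector Jacobian matrix, and left eigenvectors
   of 'J F p are the usual eigenvectors. *)
Definition unstable_direction (R : realType) (n : nat)
    (F : 'rV[R]_n -> 'rV[R]_n) (p v : 'rV[R]_n) : Prop :=
  v != 0 /\ exists2 l : R, 0 < l & v *m 'J F p = l *: v.

(* The derivative at t = 0 is two-sided, which is no restriction: a one-sided
   solution can be prolonged affinely past 0. *)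
Definition local_stable_set (R : realType) (n : nat)
    (F : 'rV[R]_n -> 'rV[R]_n) (p : 'rV[R]_n) (U : set 'rV[R]_n) :
    set 'rV[R]_n :=
  [set x | exists y : R -> 'rV[R]_n,
     [/\ y 0 = x,
         forall t : R, 0 <= t -> is_derive t 1 y (F (y t)),
         forall t : R, 0 <= t -> U (y t) &
         y t @[t --> +oo] --> p]].

Definition local_unstable_set (R : realType) (n : nat)
    (F : 'rV[R]_n -> 'rV[R]_n) (p : 'rV[R]_n) (U : set 'rV[R]_n) :
    set 'rV[R]_n :=
  [set x | exists y : R -> 'rV[R]_n,
     [/\ y 0 = x,
         forall t : R, t <= 0 -> is_derive t 1 y (F (y t)),
         forall t : R, t <= 0 -> U (y t) &
         y t @[t --> -oo] --> p]].

(* Asymptotic stability: given U, all points close enough to p have a forward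
   orbit that stays in U and converges to p.  The orbit is unique when F is
   locally Lipschitz. *)
Definition local_attractor (R : realType) (n : nat)
    (F : 'rV[R]_n -> 'rV[R]_n) (p : 'rV[R]_n) : Prop :=
  F p = 0 /\ forall U, nbhs p U -> nbhs p (local_stable_set F p U).

(* Embedded C^1 submanifold of dimension d: near each of its points, M is the
   zero set of a C^1 submersion onto a space of dimension n - d. *)
Definition C1_submanifold (R : realType) (n d : nat) (M : set 'rV[R]_n) : Prop :=
  (d <= n)%N /\
  forall x, M x -> exists (V : set 'rV[R]_n) (g : 'rV[R]_n -> 'rV[R]_(n - d)),
    [/\ open V, V x,
        forall z, V z -> differentiable g z /\ {for z, continuous (jacobian g)},
        forall z, V z -> \rank ('J g z) = (n - d)%N &
        M `&` V = [set z | g z = 0] `&` V].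

Definition has_stable_manifold (R : realType) (n : nat)
    (F : 'rV[R]_n -> 'rV[R]_n) (p : 'rV[R]_n) (d : nat) : Prop :=
  exists U : set 'rV[R]_n,
    [/\ open U, U p & C1_submanifold d (local_stable_set F p U)].

Definition has_unstable_manifold (R : realType) (n : nat)
    (F : 'rV[R]_n -> 'rV[R]_n) (p : 'rV[R]_n) (d : nat) : Prop :=
  exists U : set 'rV[R]_n,
    [/\ open U, U p & C1_submanifold d (local_unstable_set F p U)].

Definition saddle (R : realType) (n : nat) (F : 'rV[R]_n -> 'rV[R]_n)
    (p : 'rV[R]_n) (dstable dunstable : nat) : Prop :=
  [/\ F p = 0, (0 < dstable)%N, (0 < dunstable)%N &
      [/\ eigenvalue_counts F p dstable dunstable,
          (dstable + dunstable = n)%N,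
          has_stable_manifold F p dstable &
          has_unstable_manifold F p dunstable]].

(* Main.v *)
(* At a roll the Jacobian is diagonalizable with eigenvalues [- 2 beta] (radial)
   and [rho ^+ 2 * (eta - xi +/- tau / rho)], [rho] being the amplitude of the
   roll; the last two belong to the sum and difference directions of the two
   other coordinates. Stability and invariant manifolds then come from a local
   stable manifold theorem for fields with Lipschitz derivative, proved by the
   Lyapunov-Perron method: in eigencoordinates, bounded solutions with
   prescribed stable coordinates at time 0 are obtained by Picard iteration,
   and the variational equation along them gives the derivative of the graph.
   In the sup norm of the eigencoordinates these solutions never leave the box
   in which they start, so the local stable set of a small box is exactly a
   graph. Unstable manifolds are stable manifolds of the reversed field. *)

Require Import Defs.
From HB Require Import structures.
From mathcomp Require Import all_boot all_order all_algebra.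
From mathcomp Require Import all_classical all_reals all_analysis.
From mathcomp Require Import ring lra.

Import Order.TTheory GRing.Theory Num.Theory.
Import numFieldNormedType.Exports.

Local Open Scope classical_set_scope.
Local Open Scope ring_scope.

(** * Scalar linear equations on the half-line *)

(** Almost all control of orbits rests on one estimate, [solves_le]: on the half-line, a bounded
    solution of a diagonal system whose forcing is at most m/2 |y| + m/2 rho stays below rho as soon
    as its stable coordinates start below rho. Boundedness takes the place of initial data in the
    unstable coordinates. The estimate yields uniqueness, the constant 1 that confines orbits to
    their box, the differentiability of the graph and the Lipschitz bound on its derivative. A
    quadratic Taylor remainder and a Lipschitz derivative, rather than mere C^1 regularity, turn
    both statements about the derivative into inequalities of this kind, without any passage to the
    limit; the cubic field has such bounds on the unit ball around any point. *)

Lemma ler0_is_derive_nincr {R : realType} (f df : R -> R) :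
  (forall t : R, 0 <= t -> is_derive t 1 f (df t)) ->
  (forall t : R, 0 <= t -> df t <= 0) ->
  forall s t : R, 0 <= s -> s <= t -> f t <= f s.
Proof.
move=> fdf df0 s t s0 st; apply: (@ler0_derive1_nincry _ f 0) => //.
- by move=> x; rewrite in_itv/= andbT => /ltW /fdf fx; exact: ex_derive.
- move=> x; rewrite in_itv/= andbT => /ltW x0.
  by rewrite derive1E (@derive_val _ _ _ _ _ _ _ (fdf _ x0)) df0.
- apply: continuous_in_subspaceT => x; rewrite inE/= in_itv/= andbT => /fdf fx.
  exact/differentiable_continuous/derivable1_diffP/ex_derive.
Qed.

Lemma ger0_is_derive_ndecr {R : realType} (f df : R -> R) :
  (forall t : R, 0 <= t -> is_derive t 1 f (df t)) ->
  (forall t : R, 0 <= t -> 0 <= df t) ->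
  forall s t : R, 0 <= s -> s <= t -> f s <= f t.
Proof.
move=> fdf df0 s t s0 st; rewrite -lerN2.
apply: (@ler0_is_derive_nincr _ (fun t => - f t) (fun t => - df t)) => // u u0.
  by apply: is_deriveN; exact: fdf.
by rewrite oppr_le0 df0.
Qed.

Lemma is_derive_continuous {R : realType} (f : R -> R) (t d : R) :
  is_derive t 1 f d -> {for t, continuous f}.
Proof. by move=> fd; exact/differentiable_continuous/derivable1_diffP/ex_derive. Qed.

Lemma is_derive_expRl {R : realType} (mu t : R) :
  is_derive t 1 (fun s => expR (mu * s)) (mu * expR (mu * t)).
Proof.
have h : is_derive t 1 (fun s : R => mu * s) mu.
  have := @is_deriveZ _ _ _ id mu t 1 1 (is_derive_id _ _).
  by rewrite [_ *: 1]mulr1.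
by have := is_derive1_comp (f := expR) (g := fun s => mu * s) (is_derive_expR _) h; rewrite mulrC.
Qed.

Lemma is_derive_expRM {R : realType} (mu : R) (y : R -> R) (t dy : R) :
  is_derive t 1 y dy ->
  is_derive t 1 (fun s => expR (mu * s) * y s) (expR (mu * t) * (mu * y t + dy)).
Proof.
move=> yd; have := is_deriveM (is_derive_expRl mu t) yd.
by move/is_derive_eq; apply; rewrite /GRing.scale/=; ring.
Qed.

Lemma is_deriveBc {R : realType} (y : R -> R) (t dy K : R) :
  is_derive t 1 y dy -> is_derive t 1 (fun s => y s - K) dy.
Proof.
move=> yd; have := is_deriveB yd (is_derive_cst K t 1).
by move/is_derive_eq; apply; rewrite subr0.
Qed.

Section scalar_equation.
Variables (R : realType) (mu : R) (y f : R -> R).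
Hypothesis ydf : forall t : R, 0 <= t -> is_derive t 1 y (mu * y t + f t).

(** Integrating factor: expR (- mu t) (y t - K) has derivative expR (- mu t) (f t + mu K), which is
    nonpositive, and it starts at a nonpositive value. *)
Lemma stable_upper_bound (K : R) : mu < 0 -> y 0 <= K ->
  (forall t : R, 0 <= t -> f t <= - mu * K) -> forall t, 0 <= t -> y t <= K.
Proof.
move=> mu0 y0K fK t t0.
have h : forall s t : R, 0 <= s -> s <= t ->
    expR (- mu * t) * (y t - K) <= expR (- mu * s) * (y s - K).
  apply: (@ler0_is_derive_nincr _ _
    (fun s => expR (- mu * s) * (- mu * (y s - K) + (mu * y s + f s)))) => s s0.
    exact/is_derive_expRM/is_deriveBc/ydf.
  by rewrite pmulr_rle0 ?expR_gt0//; have := fK _ s0; lra.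
have {h} := h 0 t (lexx _) t0; rewrite mulr0 expR0 mul1r => h.
have : expR (- mu * t) * (y t - K) <= 0 by rewrite (le_trans h)// subr_le0.
by rewrite pmulr_rle0 ?expR_gt0// subr_le0.
Qed.

(** Once y exceeds K, the excess y - K grows at least like expR (mu t), which contradicts the bound
    B. Hence no condition on y 0 appears, and B is absent from the conclusion. *)
Lemma unstable_upper_bound (K B : R) : 0 < mu ->
  (forall t : R, 0 <= t -> y t <= B) ->
  (forall t : R, 0 <= t -> - mu * K <= f t) -> forall t, 0 <= t -> y t <= K.
Proof.
move=> mu0 yB fK t t0; rewrite leNgt; apply/negP => Ky.
have mono : forall s t : R, 0 <= s -> s <= t ->
    expR (- mu * s) * (y s - K) <= expR (- mu * t) * (y t - K).
  apply: (@ger0_is_derive_ndecr _ _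
    (fun s => expR (- mu * s) * (- mu * (y s - K) + (mu * y s + f s)))) => s s0.
    exact/is_derive_expRM/is_deriveBc/ydf.
  by rewrite pmulr_rge0 ?expR_gt0//; have := fK _ s0; lra.
have h s : t <= s -> expR (- mu * t) * (y t - K) <= expR (- mu * s) * (B - K).
  move=> ts; have s0 := le_trans t0 ts.
  rewrite (le_trans (mono _ _ t0 ts))// ler_pM2l ?expR_gt0//.
  by have := yB _ s0; lra.
have d0 : 0 < y t - K by rewrite subr_gt0.
have BK : y t - K <= B - K by have := yB _ t0; lra.
pose q := (B - K) / (y t - K).
have q0 : 0 < q by rewrite divr_gt0// (lt_le_trans d0).
have q1 : 0 <= ln q by rewrite ln_ge0// ler_pdivlMr// mul1r.
(* At this time the excess y t - K has been multiplied by at least q e, so e (B - K) would be at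
   most B - K. *)
pose s := t + (ln q + 1) / mu.
have := h s; rewrite lerDl divr_ge0 ?addr_ge0 ?(ltW mu0)// => /(_ isT).
rewrite -(ler_pM2l (expR_gt0 (mu * s))) !mulrA -!expRD.
have -> : mu * s + - mu * t = ln q + 1 by rewrite /s; field; exact: lt0r_neq0.
rewrite mulNr subrr expR0 mul1r expRD lnK ?posrE//.
rewrite mulrAC divfK ?lt0r_neq0// ger_pMr ?(lt_le_trans d0 BK)//.
by rewrite leNgt -[X in X < expR _]expR0 ltr_expR ltr01.
Qed.

End scalar_equation.

Section scalar_equation_bound.
Variables (R : realType) (mu : R) (y f : R -> R).
Hypothesis ydf : forall t : R, 0 <= t -> is_derive t 1 y (mu * y t + f t).

Let ydfN (t : R) : 0 <= t -> is_derive t 1 (fun s => - y s) (mu * - y t + - f t).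
Proof.
move=> /ydf /is_deriveN /is_derive_eq; apply.
by rewrite mulrN opprD.
Qed.

Lemma stable_bound (K : R) : mu < 0 -> `|y 0| <= K ->
  (forall t : R, 0 <= t -> `|f t| <= `|mu| * K) -> forall t, 0 <= t -> `|y t| <= K.
Proof.
move=> mu0; rewrite (ltr0_norm mu0) ler_norml => /andP[y0 y1] fK t t0.
have fK' s : 0 <= s -> - mu * - K <= f s <= - mu * K.
  by move/fK; rewrite ler_norml mulrN.
rewrite ler_norml; apply/andP; split.
  rewrite lerNl; apply: (stable_upper_bound _ _ _ (fun s => - f s) ydfN) => //.
    by rewrite lerNl.
  by move=> s /fK' /andP[+ _]; lra.
by apply: (stable_upper_bound _ _ _ _ ydf) => // s /fK' /andP[].
Qed.

Lemma unstable_bound (K B : R) : 0 < mu ->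
  (forall t : R, 0 <= t -> `|y t| <= B) ->
  (forall t : R, 0 <= t -> `|f t| <= `|mu| * K) -> forall t, 0 <= t -> `|y t| <= K.
Proof.
move=> mu0 yB; rewrite (gtr0_norm mu0) => fK t t0.
have fK' s : 0 <= s -> - mu * K <= f s <= - mu * - K.
  by move/fK; rewrite ler_norml mulrN mulNr opprK.
have yB' s : 0 <= s -> - y s <= B /\ y s <= B.
  by move/yB; rewrite ler_norml lerNl => /andP[].
rewrite ler_norml; apply/andP; split.
  rewrite lerNl; apply: (unstable_upper_bound _ _ _ (fun s => - f s) ydfN _ B) => //.
    by move=> s /yB'[].
  by move=> s /fK' /andP[_]; lra.
apply: (unstable_upper_bound _ _ _ _ ydf _ B) => // s; first by move/yB'; case.
by move=> /fK' /andP[].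
Qed.

End scalar_equation_bound.

Lemma continuous_has_primitive {R : realType} (g : R -> R) : continuous g ->
  exists G : R -> R, forall t : R, 0 <= t -> is_derive t 1 G (g t).
Proof.
move=> cg.
(* Integrating from -1 makes t = 0 an interior point, so that the derivative there is two-sided. *)
exists (fun x => (\int[lebesgue_measure]_(t in [set` `[(-1 : R), x]]) g t)%R) => t t0.
have [] := @continuous_FTC1_closed R g (-1) t (t + 1) _ _ _ (cg t).
- by rewrite ltrDl.
- apply: continuous_compact_integrable; first exact: segment_compact.
  exact: continuous_subspaceT.
- by rewrite (lt_le_trans _ t0)// ltrN10.
by move=> d1 d2; rewrite -d2 derive1E; exact: derivableP.
Qed.

(* For [mu > 0] the bounded solution is [expR (mu t) * (G t - l)], where [G] is a
   primitive of [expR (- mu t) * f t] and [l] its limit at infinity, obtained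
   here as a supremum because [G -/+ (M / mu) * expR (- mu t)] are monotone. *)
Lemma scalar_bounded_solution {R : realType} (mu a M : R) (f : R -> R) :
  mu != 0 -> continuous f -> (forall t : R, 0 <= t -> `|f t| <= M) ->
  exists y : R -> R, [/\ forall t : R, 0 <= t -> is_derive t 1 y (mu * y t + f t),
    mu < 0 -> y 0 = a & exists B, forall t : R, 0 <= t -> `|y t| <= B].
Proof.
move=> mu0 cf fM.
have M0 : 0 <= M by rewrite (le_trans _ (fM 0 _)).
have : continuous (fun t => expR (- mu * t) * f t).
  move=> t; apply: cvgM; last exact: cf.
  exact: is_derive_continuous (is_derive_expRl _ _).
move=> /continuous_has_primitive[G dG].
have key l (t : R) : 0 <= t -> is_derive t 1 (fun t => expR (mu * t) * (G t - l))
    (mu * (expR (mu * t) * (G t - l)) + f t).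
  move=> t0; have := @is_derive_expRM R mu _ t _ (is_deriveBc _ _ _ l (dG _ t0)).
  move/is_derive_eq; apply.
  rewrite mulrDr [X in _ + X]mulrA -expRD mulNr subrr expR0 mul1r; ring.
have [mun|mup|mu00] := ltgtP mu 0; last by rewrite mu00 eqxx in mu0.
  exists (fun t => expR (mu * t) * (G t - (G 0 - a))); split.
  - exact: key.
  - by move=> _; rewrite mulr0 expR0 mul1r; lra.
  - exists (Num.max `|a| (M / `|mu|)).
    apply: (stable_bound _ mu (fun t => expR (mu * t) * (G t - (G 0 - a))) f (key _)) => //.
      by rewrite mulr0 expR0 mul1r subKr le_max lexx.
    move=> t t0; rewrite (le_trans (fM _ t0))//.
    rewrite -ler_pdivrMl ?normr_gt0// mulrC le_max lexx orbT//.
pose c := M / mu.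
have dE (t : R) : is_derive t 1 (fun t => c * expR (- mu * t)) (- (M * expR (- mu * t))).
  have := @is_deriveZ _ _ _ _ c t 1 _ (is_derive_expRl (- mu) t).
  move/is_derive_eq; apply; rewrite /GRing.scale/= /c; field; exact: lt0r_neq0.
have fb t : 0 <= t -> - M * expR (- mu * t) <= expR (- mu * t) * f t <= M * expR (- mu * t).
  move=> t0; have := fM _ t0; rewrite ler_norml => /andP[f1 f2].
  by rewrite [_ * f t]mulrC !ler_pM2r ?expR_gt0// f1 f2.
have lo : forall s t : R, 0 <= s -> s <= t ->
    G s - c * expR (- mu * s) <= G t - c * expR (- mu * t).
  apply: (@ger0_is_derive_ndecr R (fun t => G t - c * expR (- mu * t))
    (fun t => expR (- mu * t) * f t - - (M * expR (- mu * t)))) => t t0.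
    exact: is_deriveB (dG _ t0) (dE t).
  by have /andP[] := fb _ t0; lra.
have hi : forall s t : R, 0 <= s -> s <= t ->
    G t + c * expR (- mu * t) <= G s + c * expR (- mu * s).
  apply: (@ler0_is_derive_nincr R (fun t => G t + c * expR (- mu * t))
    (fun t => expR (- mu * t) * f t + - (M * expR (- mu * t)))) => t t0.
    exact: is_deriveD (dG _ t0) (dE t).
  by have /andP[] := fb _ t0; lra.
have c0 : 0 <= c by rewrite divr_ge0// ltW.
have ce t : 0 <= c * expR (- mu * t) by rewrite mulr_ge0// expR_ge0.
have lohi s t : 0 <= s -> 0 <= t -> G s - c * expR (- mu * s) <= G t + c * expR (- mu * t).
  move=> s0 t0; have [st|/ltW ts] := leP s t.
    have := lo _ _ s0 st; have := ce t; lra.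
  have := hi _ _ t0 ts; have := ce s; lra.
pose E := [set G t - c * expR (- mu * t) | t in [set t | 0 <= t]].
have E0 : E !=set0 by exists (G 0 - c * expR (- mu * 0)), 0 => /=.
have Eub t : 0 <= t -> ubound E (G t + c * expR (- mu * t)).
  by move=> t0 _ [s s0 <-]; exact: lohi.
exists (fun t => expR (mu * t) * (G t - sup E)); split.
- exact: key.
- by [].
- exists c => t t0; rewrite normrM ger0_norm ?expR_ge0//.
  suff : `|G t - sup E| <= c * expR (- mu * t).
    rewrite -(ler_pM2l (expR_gt0 (mu * t))) mulrCA -expRD mulNr subrr expR0 mulr1//.
  rewrite ler_norml; apply/andP; split.
    have : sup E <= G t + c * expR (- mu * t) by apply: ge_sup => //; exact: Eub.
    lra.
  have : G t - c * expR (- mu * t) <= sup E.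
    apply: ub_le_sup; last by exists t.
    by exists (G 0 + c * expR (- mu * 0)); exact: Eub.
  lra.
Qed.

(** * Diagonal systems and Picard iteration *)

Section row_vectors.
Context {R : realType} {n : nat}.
Implicit Types (v : 'rV[R]_n) (y : R -> 'rV[R]_n).

Lemma rV_norm_le v (M : R) : 0 <= M ->
  (forall i, `|v 0 i| <= M) -> `|v| <= M.
Proof.
move=> M0 vM; rewrite [leLHS]/Num.Def.normr/= mx_normrE.
by apply: bigmax_le => // -[i j] _; rewrite ord1; exact: vM.
Qed.

Lemma rV_coord_le v i : `|v 0 i| <= `|v|.
Proof. by rewrite [leRHS]/Num.Def.normr/= mx_normrE; exact: (le_bigmax _ _ (0, i)). Qed.

Lemma rV_continuous_at y (t : R) :
  (forall i, {for t, continuous (fun s => y s 0 i)}) -> {for t, continuous y}.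
Proof.
move=> yc; apply/cvgrPdist_le => e e0; near=> s.
apply: rV_norm_le; first exact: ltW.
move=> i; rewrite !mxE; move: i; near: s; apply: filter_forall => i.
exact: (cvgrPdist_le _ _).1 (yc i) _ e0.
Unshelve. all: by end_near. Qed.

Lemma is_derive_rV y (t : R) (d : 'rV[R]_n) : is_derive t 1 y d <->
  forall i, is_derive t 1 (fun s => y s 0 i) (d 0 i).
Proof.
split=> [yd i|yd].
  have yt : derivable y t 1 by exact: ex_derive.
  have := derive_mx yt; rewrite derive_val => ->; rewrite mxE.
  by apply: derivableP; exact: (derivable_mxP _ _ _).1 yt 0 i.
have yt : derivable y t 1.
  by apply/derivable_mxP => i j; rewrite ord1; exact: ex_derive.
suff -> : d = 'D_1 y t by exact: derivableP.
by rewrite derive_mx//; apply/rowP => j; rewrite mxE derive_val.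
Qed.

End row_vectors.

(** Nested intervals: the steps after index k add up to at most d k = 2 K / 2^k, so v k - d k
    increases and v k + d k decreases. The supremum of the lower ends is the limit, with an explicit
    rate. *)
Lemma dyadic_cauchy {R : realType} (v : nat -> R) (K : R) :
  (forall k, `|v k.+1 - v k| <= K / 2 ^+ k) ->
  exists l, forall k, `|l - v k| <= 2 * K / 2 ^+ k.
Proof.
move=> vK.
pose d k : R := 2 * K / 2 ^+ k.
have dS k : K / 2 ^+ k = d k - d k.+1.
  by rewrite /d exprS; field; rewrite expf_neq0.
have K0 : 0 <= K by have := vK 0; rewrite expr0 divr1; exact: le_trans.
have d0 k : 0 <= d k by rewrite /d divr_ge0 ?exprn_ge0// mulr_ge0.
have step k : v k - d k <= v k.+1 - d k.+1 /\ v k.+1 + d k.+1 <= v k + d k.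
  by have := vK k; rewrite dS ler_norml => /andP[? ?]; split; lra.
have lo : {homo (fun k => v k - d k) : i j / (i <= j)%N >-> i <= j}.
  by apply: homo_leq => // [x y z|k]; [exact: le_trans|have [] := step k].
have hi : {homo (fun k => v k + d k) : i j / (i <= j)%N >-> j <= i}.
  apply: (@homo_leq _ (fun k => v k + d k) (fun a b => b <= a)) => // [x y z|k].
    by move=> yx zy; exact: le_trans zy yx.
  by have [] := step k.
have lohi j k : v j - d j <= v k + d k.
  have [jk|/ltnW kj] := leqP j k.
    by have := lo _ _ jk; have := d0 k; lra.
  by have := hi _ _ kj; have := d0 j; lra.
pose E := [set v k - d k | k in [set: nat]].
exists (sup E) => k; rewrite -/(d k) ler_norml; apply/andP; split.
  suff : v k - d k <= sup E by lra.
  by apply: ub_le_sup; [exists (v 0 + d 0) => _ [j _ <-]; exact: lohi|exists k].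
suff : sup E <= v k + d k by lra.
by apply: ge_sup; [exists (v 0 - d 0), 0|move=> _ [j _ <-]; exact: lohi].
Qed.

Section diagonal_system.
Context {R : realType} {n : nat}.
Variables (mu : 'rV[R]_n) (m : R).
Hypotheses (m0 : 0 < m) (mu_ge : forall i, m <= `|mu 0 i|).
Implicit Types (y f : R -> 'rV[R]_n).

(** The forcing f is a function of time alone; a nonlinear equation is expressed by letting f be a
    function composed with y. *)
Definition solves y f := forall i (t : R), 0 <= t ->
  is_derive t 1 (fun s => y s 0 i) (mu 0 i * y t 0 i + f t 0 i).

Lemma solvesB y f y' f' : solves y f -> solves y' f' ->
  solves (fun t => y t - y' t) (fun t => f t - f' t).
Proof.
move=> yf yf' i t t0; have := is_deriveB (yf i t t0) (yf' i t t0).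
have -> : (fun s => y s 0 i) - (fun s => y' s 0 i) = (fun s => (y s - y' s) 0 i).
  by apply/funext => s; rewrite !mxE.
by move/is_derive_eq; apply; rewrite !mxE; ring.
Qed.

Lemma solves_ext y f f' : (forall t, 0 <= t -> f t = f' t) ->
  solves y f -> solves y f'.
Proof. by move=> ff yf i t t0; rewrite -ff//; exact: yf. Qed.

(** Coordinatewise, m rho is at most |mu_i| rho, the forcing that the scalar bounds allow. The
    unstable coordinates are controlled by the existence of B, the stable ones by their initial
    values. *)
Lemma solves_bound y f (rho B : R) : solves y f ->
  (forall t, 0 <= t -> `|y t| <= B) ->
  (forall t, 0 <= t -> `|f t| <= m * rho) ->
  (forall i, mu 0 i < 0 -> `|y 0 0 i| <= rho) ->
  forall t, 0 <= t -> `|y t| <= rho.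
Proof.
move=> yf yB frho y0 t t0.
have rho0 : 0 <= rho.
  by rewrite -(pmulr_rge0 _ m0); exact: le_trans (normr_ge0 _) (frho _ t0).
apply: rV_norm_le => // i.
have fi s : 0 <= s -> `|f s 0 i| <= `|mu 0 i| * rho.
  move=> s0; apply: (le_trans (rV_coord_le _ i)).
  exact: le_trans (frho _ s0) (ler_wpM2r rho0 (mu_ge i)).
have [mui|mui|mui] := ltgtP (mu 0 i) 0.
- exact: (stable_bound _ _ (fun s => y s 0 i) (fun s => f s 0 i) (yf i)) (y0 _ mui) _ _ t0.
- apply: (unstable_bound _ _ (fun s => y s 0 i) (fun s => f s 0 i) (yf i) _ B) => // s s0.
  exact: le_trans (rV_coord_le _ i) (yB _ s0).
- by have := lt_le_trans m0 (mu_ge i); rewrite mui normr0 ltxx.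
Qed.

(** With S the supremum of |y|, the forcing is at most m (S + rho) / 2, so [solves_bound] improves S
    to (S + rho) / 2. This forces S to be at most rho. *)
Lemma solves_le y f (rho B : R) : solves y f ->
  (forall t, 0 <= t -> `|y t| <= B) ->
  0 <= rho -> (forall t, 0 <= t -> `|f t| <= m / 2 * `|y t| + m / 2 * rho) ->
  (forall i, mu 0 i < 0 -> `|y 0 0 i| <= rho) ->
  forall t, 0 <= t -> `|y t| <= rho.
Proof.
move=> yf yB rho0 frho y0.
pose E := [set `|y t| | t in [set t : R | 0 <= t]].
have supE : has_sup E.
  split; first by exists `|y 0|, 0 => /=.
  by exists B => _ [t t0 <-]; exact: yB.
have yS t : 0 <= t -> `|y t| <= sup E.
  by move=> t0; apply: sup_ubound; [case: supE|exists t].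
have [Srho|Srho] := leP (sup E) rho.
  by move=> t t0; exact: le_trans (yS _ t0) Srho.
have yh t : 0 <= t -> `|y t| <= (sup E + rho) / 2.
  apply: (solves_bound _ _ _ B yf) => // [s s0|i mui].
    rewrite (le_trans (frho _ s0))// -mulrDr.
    rewrite mulrAC -mulrA ler_pM2l// ler_pM2r ?invr_gt0// lerD2r.
    exact: yS.
  by rewrite (le_trans (y0 _ mui))//; lra.
have : sup E <= (sup E + rho) / 2.
  by apply: ge_sup; [case: supE|move=> _ [t t0 <-]; exact: yh].
by move: Srho => + /ltac:(lra).
Qed.

Lemma solves_uniq y f y' f' (B B' : R) : solves y f -> solves y' f' ->
  (forall t, 0 <= t -> `|y t| <= B) -> (forall t, 0 <= t -> `|y' t| <= B') ->
  (forall t, 0 <= t -> `|f t - f' t| <= m / 2 * `|y t - y' t|) ->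
  (forall i, mu 0 i < 0 -> y 0 0 i = y' 0 0 i) ->
  forall t, 0 <= t -> y t = y' t.
Proof.
move=> yf yf' yB yB' ff y0 t t0; apply/eqP; rewrite -subr_eq0 -normr_le0.
apply: (solves_le _ _ 0 (B + B') (solvesB _ _ _ _ yf yf')) => // [s s0|s s0|i mui].
- by rewrite (le_trans (ler_normB _ _))// lerD ?yB ?yB'.
- by rewrite mulr0 addr0 ff.
- by rewrite !mxE y0// subrr normr0.
Qed.

(** The equation says nothing at negative times, so y is frozen at its initial value there; the
    two-sided derivative at 0 makes the result continuous on the whole line. *)
Lemma solves_continuous y f : solves y f ->
  continuous (fun t : R => y (Num.max t 0)).
Proof.
move=> yf t.
have mt : {for t, continuous (fun t : R => Num.max t 0)}.
  by apply: (@continuous_max _ _ id (cst 0) t); [exact: cvg_id|exact: cvg_cst].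
apply: (@continuous_comp _ _ _ (fun t : R => Num.max t 0) y) => //.
apply: rV_continuous_at => i; apply: is_derive_continuous (yf i _ _).
by rewrite le_max lexx orbT.
Qed.

Lemma solves_exists (a : 'rV[R]_n) f (M : R) : continuous f ->
  (forall t, 0 <= t -> `|f t| <= M) ->
  exists y, [/\ solves y f, forall i, mu 0 i < 0 -> y 0 0 i = a 0 i &
    exists B, forall t, 0 <= t -> `|y t| <= B].
Proof.
move=> cf fM.
have : forall i, exists y : R -> R,
    [/\ forall t : R, 0 <= t -> is_derive t 1 y (mu 0 i * y t + f t 0 i),
      mu 0 i < 0 -> y 0 = a 0 i & exists B, forall t, 0 <= t -> `|y t| <= B].
  move=> i; apply: (scalar_bounded_solution _ _ M (fun t => f t 0 i)).
  - by apply: contraTneq (lt_le_trans m0 (mu_ge i)) => ->; rewrite normr0 ltxx.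
  - move=> t; apply: (@continuous_comp _ _ _ f (fun v : 'rV[R]_n => v 0 i)).
      exact: cf.
    exact: coord_continuous.
  - by move=> t t0; exact: le_trans (rV_coord_le _ i) (fM _ t0).
move=> /choice[y yP]; exists (fun t => \row_i y i t); split.
- move=> i t t0; have [yd _ _] := yP i.
  have -> : (fun s => (\row_i0 y i0 s) 0 i) = y i by apply/funext => s; rewrite mxE.
  by rewrite mxE; exact: yd.
- by move=> i mui; rewrite mxE; have [_ -> ] := yP i.
have : forall i, exists B, forall t, 0 <= t -> `|y i t| <= B.
  by move=> i; have [_ _] := yP i.
move=> /choice[B BP]; exists (\sum_i `|B i|) => t t0.
apply: rV_norm_le => [|i]; first exact: sumr_ge0.
rewrite mxE (le_trans (BP _ _ t0))// (le_trans (ler_norm _))//.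
by rewrite (bigD1 i)//= lerDl sumr_ge0.
Qed.

(* Picard iteration for the Lyapunov-Perron operator: the equation is solved
   among bounded functions, with only the stable coordinates prescribed at 0. *)
Lemma semilinear_solution (N : R -> 'rV[R]_n -> 'rV[R]_n) (a : 'rV[R]_n) :
  (forall t x x', `|N t x - N t x'| <= m / 2 * `|x - x'|) ->
  (forall t, N t 0 = 0) ->
  (forall y, continuous y -> continuous (fun t => N t (y t))) ->
  exists y, [/\ solves y (fun t => N t (y t)),
    forall i, mu 0 i < 0 -> y 0 0 i = a 0 i &
    exists B, forall t, 0 <= t -> `|y t| <= B].
Proof.
move=> NL N0 Nc.
pose c (t : R) := Num.max t 0.
have c0 t : 0 <= c t by rewrite /c le_max lexx orbT.
have ct t : 0 <= t -> c t = t by move=> t0; rewrite /c max_l.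
pose X y := continuous (fun t => y (c t)) /\ exists B, forall t, 0 <= t -> `|y t| <= B.
(* One Picard step, as a relation: solving the linear equation only gives existence, and choice then
   turns it into the map that is iterated. *)
pose T x y := [/\ solves y (fun t => N t (x (c t))),
  forall i, mu 0 i < 0 -> y 0 0 i = a 0 i & X y].
have NB t x : `|N t x| <= m / 2 * `|x|.
  by have := NL t x 0; rewrite N0 !subr0.
have exT x : exists y, X x -> T x y.
  have [[cx [B xB]]|nX] := pselect (X x); last by exists 0.
  have [] := @solves_exists a (fun t => N t (x (c t))) (m / 2 * B).
  - exact: Nc.
  - by move=> t t0; rewrite (le_trans (NB _ _))// ler_pM2l ?divr_gt0// ct// xB.
  by move=> y [yf ya yB]; exists y => _; split => //; split => //; exact: solves_continuous yf.
have [F FT] := choice exT.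
pose x k := iter k F (fun=> 0).
have Xx k : X (x k).
  elim: k => [|k IH]; last by have [] := FT _ IH.
  split; first by move=> t; exact: cvg_cst.
  by exists 0 => t _; rewrite normr0.
have xT k : T (x k) (x k.+1) by exact: FT.
(* Contraction with factor 1/2: the Lipschitz constant m/2 is measured against the spectral gap
   m. *)
have diffP (u v u' v' : R -> 'rV[R]_n) (K : R) : T u u' -> T v v' ->
    (forall t, 0 <= t -> `|u t - v t| <= K) ->
    forall t, 0 <= t -> `|u' t - v' t| <= K / 2.
  move=> [u'f u'a [_ [B uB]]] [v'f v'a [_ [B' vB]]] uvK t t0.
  have K0 : 0 <= K by exact: le_trans (normr_ge0 _) (uvK _ t0).
  apply: (solves_bound _ _ _ (B + B') (solvesB _ _ _ _ u'f v'f)) => // [s s0|s s0|i mui].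
  - by rewrite (le_trans (ler_normB _ _))// lerD ?uB ?vB.
  - rewrite (le_trans (NL _ _ _))// -mulrA ler_pM2l// [leLHS]mulrC.
    by rewrite ler_pM2r ?invr_gt0// ct// uvK.
  - by rewrite !mxE u'a// v'a// subrr normr0 divr_ge0.
have [K xK] : exists K, forall k t, 0 <= t -> `|x k.+1 t - x k t| <= K / 2 ^+ k.
  have [_ [K x1K]] := Xx 1; exists K; elim=> [t t0|k IH t t0].
    by rewrite expr0 divr1 [x 0 t]/(0) subr0 x1K.
  by rewrite exprSr invfM mulrA; exact: diffP (xT _) (xT _) IH _ t0.
have K0 : 0 <= K.
  by have := xK 0 0 (lexx _); rewrite expr0 divr1; exact: le_trans (normr_ge0 _).
have : forall t, exists l : 'rV[R]_n, forall k, `|l - x k (c t)| <= 2 * K / 2 ^+ k.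
  move=> t.
  have : forall i, exists l, forall k, `|l - x k (c t) 0 i| <= 2 * K / 2 ^+ k.
    move=> i; apply: dyadic_cauchy => k; rewrite (le_trans _ (xK k _ (c0 t)))//.
    by have := rV_coord_le (x k.+1 (c t) - x k (c t)) i; rewrite !mxE.
  move=> /choice[l lP]; exists (\row_i l i) => k.
  apply: rV_norm_le => [|i]; last by rewrite !mxE.
  by rewrite divr_ge0 ?exprn_ge0// mulr_ge0.
move=> /choice[l lP].
have tail (e : R) : 0 < e -> exists k, 2 * K / 2 ^+ k <= e.
  move=> e0; pose k := Num.bound (2 * K / e); exists k.
  rewrite ler_pdivrMr ?exprn_gt0// [leRHS]mulrC -ler_pdivrMr//.
  have Ke : 2 * K / e < k%:R.
    by apply: archi_boundP; rewrite divr_ge0 ?mulr_ge0// ltW.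
  by rewrite (le_trans (ltW Ke))// -natrX ler_nat ltnW// ltn_expl.
(* The limits were chosen separately for each t, so that l depends on [c t] only has to be derived
   from uniqueness of limits. *)
have lc t : l (c t) = l t.
  apply/eqP; rewrite -subr_eq0 -normr_le0; apply/ler_addgt0Pr => e e0.
  have [k ke] := tail (e / 2) ltac:(lra).
  have := lP t k; have := lP (c t) k; rewrite (ct _ (c0 t)) => h1 h2.
  rewrite add0r -(subrKA (x k (c t))) (le_trans (ler_normD _ _))//.
  by rewrite (splitr e) lerD ?(le_trans h1)// distrC (le_trans h2).
have Xl : X l.
  split.
    move=> t; rewrite /continuous_at; apply/cvgrPdist_le => e e0.
    have [k ke] := tail (e / 3) ltac:(lra).
    have /cvgrPdist_le/(_ (e / 3) ltac:(lra)) := (Xx k).1 t.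
    apply: filterS => s xs; rewrite !lc.
    have := lP s k => /le_trans/(_ ke) hs; have := lP t k => /le_trans/(_ ke) ht.
    have -> : l t - l s = (l t - x k (c t)) + (x k (c t) - x k (c s)) - (l s - x k (c s)).
      by apply/rowP => i; rewrite !mxE; ring.
    rewrite (le_trans (ler_normB _ _))// (le_trans (lerD (ler_normD _ _) (lexx _)))//.
    by lra.
  have [_ [B x0B]] := Xx 0; exists (2 * K + B) => t t0.
  have := lP t 0; rewrite expr0 divr1 ct// => h.
  rewrite -[l t](subrK (x 0 t)) (le_trans (ler_normD _ _))// lerD ?x0B//.
have [y yT] := exT l; have {}yT := yT Xl.
(* The limit is a fixed point: y and x (k+1) are images of l and x k, so they are as close as one
   wishes, while x (k+1) tends to l. *)
have yl t : 0 <= t -> y t = l t.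
  move=> t0; apply/eqP; rewrite -subr_eq0 -normr_le0; apply/ler_addgt0Pr => e e0.
  have [k ke] := tail (e / 2) ltac:(lra).
  have lx s : 0 <= s -> `|l s - x k s| <= e / 2.
    by move=> s0; rewrite (le_trans _ ke)// -{2}(ct _ s0).
  have h := diffP _ _ _ _ _ yT (xT k) lx _ t0.
  have h' := lP t k.+1; rewrite ct// in h'.
  have h2 : `|l t - x k.+1 t| <= e / 2.
    rewrite (le_trans h')// (le_trans _ ke)// ler_wpM2l ?mulr_ge0//.
    by rewrite lef_pV2 ?posrE ?exprn_gt0// ler_eXn2l// ltr1n.
  rewrite add0r -(subrKA (x k.+1 t)) (le_trans (ler_normD _ _))//.
  rewrite [X in _ + X]distrC; lra.
case: yT => yf ya [_ yB]; exists y; split => //.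
by apply: solves_ext yf => t t0; rewrite ct// yl.
Qed.

End diagonal_system.

(** * The stable set in eigencoordinates *)

Definition cball {R : realType} {n : nat} (p : 'rV[R]_n) (r : R) : set 'rV[R]_n :=
  [set x | `|x - p| <= r].

(* [J] is a Jacobian of [f] on [A] in the row-vector convention, with quadratic
   Taylor remainder and Lipschitz dependence on the base point. *)
Definition C11 {R : realType} {n k : nat} (A : set 'rV[R]_n) (C : R)
    (f : 'rV[R]_n -> 'rV[R]_k) (J : 'rV[R]_n -> 'M[R]_(n, k)) : Prop :=
  (forall x x', A x -> A x' ->
     `|f x' - f x - (x' - x) *m J x| <= C * `|x' - x| ^+ 2) /\
  (forall x x' (h : 'rV[R]_n), A x -> A x' -> `|h *m (J x' - J x)| <= C * `|x' - x| * `|h|).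

Lemma max_lipschitz {R : realDomainType} (c a b : R) :
  `|Num.max c a - Num.max c b| <= `|a - b|.
Proof.
wlog ab : a b / b <= a => [h|].
  by have [/h|/ltW/h] := leP b a; rewrite // distrC [leRHS]distrC.
rewrite (ger0_norm (_ : 0 <= a - b)) ?subr_ge0// ler_norml.
by apply/andP; split; case: (leP c a) => ?; case: (leP c b) => ?; lra.
Qed.

Lemma min_lipschitz {R : realDomainType} (c a b : R) :
  `|Num.min c a - Num.min c b| <= `|a - b|.
Proof.
wlog ab : a b / b <= a => [h|].
  by have [/h|/ltW/h] := leP b a; rewrite // distrC [leRHS]distrC.
rewrite (ger0_norm (_ : 0 <= a - b)) ?subr_ge0// ler_norml.
by apply/andP; split; case: (leP c a) => ?; case: (leP c b) => ?; lra.
Qed.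

Section clamp.
Context {R : realType} {n : nat}.
Implicit Types x : 'rV[R]_n.

(** Retraction onto the sup-norm ball, 1-Lipschitz for that norm. Composing with it makes a
    nonlinearity globally Lipschitz, as Picard iteration requires. It is not smooth, but derivatives
    are only taken along orbits in the ball, where it is the identity. *)
Definition clamp (r : R) x : 'rV[R]_n :=
  \row_i Num.max (- r) (Num.min r (x 0 i)).

Lemma clamp_le r x : 0 <= r -> `|clamp r x| <= r.
Proof.
move=> r0; apply: rV_norm_le => // i; rewrite mxE ler_norml.
by rewrite le_max lexx/= ge_max ge_min lexx ge0_cp.
Qed.

Lemma clamp_id r x : `|x| <= r -> clamp r x = x.
Proof.
move=> xr; apply/rowP => i; rewrite mxE.
have := le_trans (rV_coord_le x i) xr; rewrite ler_norml => /andP[h1 h2].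
by rewrite min_r// max_r.
Qed.

Lemma clamp_lipschitz r x x' : `|clamp r x - clamp r x'| <= `|x - x'|.
Proof.
apply: rV_norm_le => // i; rewrite !mxE.
apply: le_trans (rV_coord_le (x - x') i); rewrite !mxE.
exact: le_trans (max_lipschitz _ _ _) (min_lipschitz _ _ _).
Qed.

End clamp.
(** Meant for the variational equation, where M t is a Jacobian along a curve x: operator bounds in
    the form provided by [C11] are enough. *)
Lemma bounded_continuousM {R : realType} {n k : nat} (y : R -> 'rV[R]_n)
    (M : R -> 'M[R]_(n, k)) (L : R) (x : R -> 'rV[R]_n) :
  continuous y -> continuous x ->
  (forall t (h : 'rV[R]_n), `|h *m M t| <= L * `|h|) ->
  (forall s t (h : 'rV[R]_n), `|h *m (M s - M t)| <= L * `|x s - x t| * `|h|) ->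
  continuous (fun t => y t *m M t).
Proof.
move=> yc xc ML MLip t; rewrite /continuous_at; apply/cvgrPdist_le => e e0.
have : (L * `|y t - y s| + L * `|x t - x s| * `|y s|) @[s --> t] --> (0 : R).
  have -> : 0 = L * `|y t - y t| + L * `|x t - x t| * `|y t| :> R.
    by rewrite !subrr !normr0; ring.
  apply: cvgD; first by apply: cvgMr; apply: cvg_norm; apply: cvgB; [exact: cvg_cst|exact: yc].
  apply: cvgM; last by apply: cvg_norm; exact: yc.
  by apply: cvgMr; apply: cvg_norm; apply: cvgB; [exact: cvg_cst|exact: xc].
move=> /cvgrPdist_le/(_ e e0); apply: filterS => s.
rewrite sub0r normrN => /(le_trans (ler_norm _)); apply: le_trans.
have -> : y t *m M t - y s *m M s = (y t - y s) *m M t + y s *m (M t - M s).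
  by rewrite mulmxBl mulmxBr subrKA.
by rewrite (le_trans (ler_normD _ _))// lerD.
Qed.

(** * Lyapunov-Perron construction of the local stable graph *)

Section lyapunov_perron.
Context {R : realType} {n : nat}.
Implicit Types a b x : 'rV[R]_n.
Variables (mu : 'rV[R]_n) (m C r : R).
Variables (N : 'rV[R]_n -> 'rV[R]_n) (J : 'rV[R]_n -> 'M[R]_n).
Hypotheses (m0 : 0 < m) (mu_ge : forall i, 2 * m <= `|mu 0 i|).
Hypotheses (r0 : 0 < r) (C0 : 0 <= C) (rm : 3 * C * r <= m / 2).
Hypotheses (NJ : C11 (cball 0 r) C N J) (N0 : N 0 = 0) (J0 : J 0 = 0).

Let mu_m i : m <= `|mu 0 i|. Proof. by have := mu_ge i; have := m0; lra. Qed.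

Let Nc x := N (clamp r x).

Let in_ball x : `|x| <= r -> cball 0 r x.
Proof. by rewrite /cball/= subr0. Qed.

Let J_le x (h : 'rV[R]_n) : `|x| <= r -> `|h *m J x| <= m / 2 * `|h|.
Proof.
move=> xr; have := NJ.2 0 x h (in_ball 0 _) (in_ball x xr).
rewrite J0 !subr0 normr0 => /(_ (ltW r0)) /le_trans; apply.
rewrite ler_wpM2r// (le_trans _ rm)//.
have : C * `|x| <= C * r by rewrite ler_wpM2l.
by have := mulr_ge0 C0 (ltW r0); lra.
Qed.

(** The Taylor remainder contributes C |x' - x|, at most 2 C r, and the linear part C |x|, at most C
    r: this is the factor 3 in [rm]. *)
Let N_lip x x' : `|x| <= r -> `|x'| <= r -> `|N x' - N x| <= m / 2 * `|x' - x|.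
Proof.
move=> xr x'r.
have h1 := NJ.1 x x' (in_ball _ xr) (in_ball _ x'r).
have h2 := NJ.2 0 x (x' - x) (in_ball 0 _) (in_ball _ xr).
rewrite J0 !subr0 normr0 in h2; have {}h2 := h2 (ltW r0).
have -> : N x' - N x = (N x' - N x - (x' - x) *m J x) + (x' - x) *m J x.
  by rewrite subrK.
rewrite (le_trans (ler_normD _ _))// (le_trans (lerD h1 h2))//.
rewrite expr2 mulrA -mulrDl ler_wpM2r// (le_trans _ rm)//.
have d : `|x' - x| <= 2 * r by rewrite (le_trans (ler_normB _ _))//; lra.
have : C * `|x' - x| <= C * (2 * r) by rewrite ler_wpM2l.
have : C * `|x| <= C * r by rewrite ler_wpM2l.
lra.
Qed.

Let Nc_lip x x' : `|Nc x - Nc x'| <= m / 2 * `|x - x'|.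
Proof.
apply: le_trans (N_lip _ _ _ _) _; rewrite ?clamp_le ?(ltW r0)//.
by rewrite ler_wpM2l ?clamp_lipschitz ?divr_ge0 ?(ltW m0).
Qed.

Let Nc0 : Nc 0 = 0.
Proof. by rewrite /Nc clamp_id ?normr0 ?(ltW r0). Qed.

Let Nc_le x : `|Nc x| <= m / 2 * `|x|.
Proof. by have := Nc_lip x 0; rewrite Nc0 !subr0. Qed.

Let Nc_continuous : continuous Nc.
Proof.
move=> x; apply/(cvgrPdist_le (FF := nbhs_filter x)) => e e0.
have /cvgrPdist_le/(_ (e / (m / 2))) : z @[z --> x] --> x by exact: cvg_id.
rewrite !divr_gt0// => /(_ isT); apply: filterS => z xz.
by rewrite (le_trans (Nc_lip _ _))// mulrC -ler_pdivlMr ?divr_gt0.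
Qed.

(* Exponential decay comes from solving the equation for
   [expR (m * t) *: y t], whose rates [mu + m] have the same signs. *)
Let orbit_exists (a : 'rV[R]_n) : exists y : R -> 'rV[R]_n,
  [/\ solves mu y (fun t => Nc (y t)), forall i, mu 0 i < 0 -> y 0 0 i = a 0 i &
    exists B, forall t, 0 <= t -> `|y t| <= B * expR (- m * t)].
Proof.
pose nu : 'rV[R]_n := mu + const_mx m.
have nuE i : nu 0 i = mu 0 i + m by rewrite !mxE.
(* Shifting the rates by m costs m of the gap, which is why [mu_ge] asks for 2 m. *)
have nu_ge i : m <= `|nu 0 i|.
  by rewrite nuE; have := m0; have := mu_ge i; rewrite ler_normr => /orP[h|h] ?; rewrite ler_normr;
    apply/orP; [left|right]; lra.
have nu_lt i : (mu 0 i < 0) -> (nu 0 i < 0).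
  by rewrite nuE; have := m0; have := mu_ge i; rewrite ler_normr; have := m0 => ? /orP[h|h]; lra.
pose N' t z := expR (m * t) *: Nc (expR (- m * t) *: z).
have ee t : expR (m * t) * expR (- m * t) = 1 by rewrite -expRD mulNr subrr expR0.
have [] := @semilinear_solution R n nu m m0 nu_ge N' a.
- move=> t x x'; rewrite /N' -scalerBr normrZ ger0_norm ?expR_ge0//.
  rewrite (le_trans (ler_wpM2l (expR_ge0 _) (Nc_lip _ _)))//.
  rewrite -scalerBr normrZ ger0_norm ?expR_ge0//.
  have -> : expR (m * t) * (m / 2 * (expR (- m * t) * `|x - x'|)) =
      (expR (m * t) * expR (- m * t)) * (m / 2 * `|x - x'|) by ring.
  by rewrite ee mul1r.
- by move=> t; rewrite /N' scaler0 Nc0 scaler0.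
- move=> y yc t; apply: cvgZ; first exact: is_derive_continuous (is_derive_expRl _ _).
  apply: (@continuous_comp _ _ _ (fun t => expR (- m * t) *: y t) Nc).
    apply: cvgZ; first exact: is_derive_continuous (is_derive_expRl _ _).
    exact: yc.
  exact: Nc_continuous.
move=> z [zN za [B zB]]; exists (fun t => expR (- m * t) *: z t); split.
- move=> i t t0; have := is_derive_expRM (- m) _ _ _ (zN i t t0).
  have -> : (fun s => expR (- m * s) * z s 0 i) = (fun s => (expR (- m * s) *: z s) 0 i).
    by apply/funext => s; rewrite mxE.
  move/is_derive_eq; apply; rewrite nuE /N' !mxE.
  have -> : expR (- m * t) * (- m * z t 0 i + ((mu 0 i + m) * z t 0 i +
      expR (m * t) * Nc (expR (- m * t) *: z t) 0 i)) =
    mu 0 i * (expR (- m * t) * z t 0 i) + (expR (m * t) * expR (- m * t)) * Nc (expR (- m * t) *: z t) 0 i by ring.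
  by rewrite ee mul1r.
- by move=> i mui; rewrite mulr0 expR0 scale1r za// nu_lt.
- exists B => t t0; rewrite normrZ ger0_norm ?expR_ge0// mulrC.
  by rewrite ler_wpM2r ?expR_ge0// zB.
Qed.

Let Y (a : 'rV[R]_n) : R -> 'rV[R]_n := sval (cid (orbit_exists a)).

Let Y_solves a : solves mu (Y a) (fun t => Nc (Y a t)).
Proof. by rewrite /Y; case: cid => y []. Qed.

Let Y_stable a i : mu 0 i < 0 -> Y a 0 0 i = a 0 i.
Proof. by rewrite /Y; case: cid => y [_ /= + _]; apply. Qed.

Let Y_decay a : exists B, forall t, 0 <= t -> `|Y a t| <= B * expR (- m * t).
Proof. by rewrite /Y; case: cid => y []. Qed.

Let Y_bounded a : exists B, forall t, 0 <= t -> `|Y a t| <= B.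
Proof.
have [B YB] := Y_decay a; exists `|B| => t t0.
rewrite (le_trans (YB _ t0))// (le_trans (ler_norm _))// normrM.
rewrite ler_piMr// ger0_norm ?expR_ge0// expR_le1 mulNr oppr_le0.
by rewrite mulr_ge0// ltW.
Qed.

(** The constant is 1: orbits never separate further than their stable coordinates at time 0 allow.
    Comparison with the zero orbit keeps Y a in the ball of radius |a|, so the truncation is
    inactive when |a| is at most r. *)
Let Y_dist a b rho : 0 <= rho ->
  (forall i, mu 0 i < 0 -> `|a 0 i - b 0 i| <= rho) ->
  forall t, 0 <= t -> `|Y a t - Y b t| <= rho.
Proof.
move=> rho0 ab; have [B YB] := Y_bounded a; have [B' YB'] := Y_bounded b.
apply: (solves_le mu m m0 mu_m _ _ _ (B + B') (solvesB _ _ _ _ _ (Y_solves a) (Y_solves b))) => //.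
- by move=> t t0; rewrite (le_trans (ler_normB _ _))// lerD ?YB ?YB'.
- move=> t t0; rewrite (le_trans (Nc_lip _ _))// lerDl.
  by rewrite mulr_ge0// divr_ge0// ltW.
- by move=> i mui; rewrite !mxE !Y_stable// ab.
Qed.

Let Y0 t : 0 <= t -> Y 0 t = 0.
Proof.
have [B YB] := Y_bounded 0.
apply: (solves_uniq mu m m0 mu_m _ _ (fun=> 0) (fun=> 0) B 0 (Y_solves 0)) => //.
- by move=> i s s0; rewrite !mxE mulr0 addr0; exact: is_derive_cst.
- by move=> s s0; rewrite normr0.
- by move=> s s0; rewrite !subr0 Nc_le.
- by move=> i mui; rewrite Y_stable.
Qed.

Let Y_le a t : 0 <= t -> `|Y a t| <= `|a|.
Proof.
move=> t0; rewrite -[Y a t]subr0 -(Y0 t t0); apply: Y_dist => // i _.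
by rewrite mxE subr0; exact: rV_coord_le.
Qed.

(** The bounded solution of the variational equation along Y a is the candidate derivative of Y at a
    in the direction b. *)
Let Z_exists (a b : 'rV[R]_n) : `|a| <= r -> exists z : R -> 'rV[R]_n,
  [/\ solves mu z (fun t => z t *m J (Y a t)), forall i, mu 0 i < 0 -> z 0 0 i = b 0 i &
    exists B, forall t, 0 <= t -> `|z t| <= B].
Proof.
move=> ar; pose x t := Y a (Num.max t 0).
have xr t : `|x t| <= r.
  by rewrite (le_trans _ ar)// Y_le// le_max lexx orbT.
have [] := @semilinear_solution R n mu m m0 mu_m (fun t z => z *m J (x t)) b.
- by move=> t v v'; rewrite -mulmxBl J_le.
- by move=> t; rewrite mul0mx.
- move=> y yc; apply: (bounded_continuousM _ _ (m / 2 + C) x) => //.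
  + exact: solves_continuous (Y_solves a).
  + move=> t h; rewrite (le_trans (J_le _ _ (xr t)))// ler_wpM2r//; have := C0; lra.
  + move=> s t h; rewrite (le_trans (NJ.2 _ _ _ (in_ball _ (xr t)) (in_ball _ (xr s))))//.
    rewrite -!mulrA ler_wpM2r ?mulr_ge0//; have := m0; lra.
move=> z [zJ za zB]; exists z; split => //.
by apply: solves_ext zJ => t t0; rewrite /x max_l.
Qed.

Let Z (a b : 'rV[R]_n) : R -> 'rV[R]_n :=
  if pselect (`|a| <= r) is left ar then sval (cid (Z_exists a b ar)) else fun=> 0.

Let Z_P a b : `|a| <= r ->
  [/\ solves mu (Z a b) (fun t => Z a b t *m J (Y a t)),
    forall i, mu 0 i < 0 -> Z a b 0 0 i = b 0 i &
    exists B, forall t, 0 <= t -> `|Z a b t| <= B].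
Proof. by move=> ar; rewrite /Z; case: pselect => // ar'; case: cid. Qed.

Let Z_le a b rho : `|a| <= r -> 0 <= rho ->
  (forall i, mu 0 i < 0 -> `|b 0 i| <= rho) ->
  forall t, 0 <= t -> `|Z a b t| <= rho.
Proof.
move=> ar rho0 brho; have [Zs Zb [B ZB]] := Z_P a b ar.
apply: (solves_le mu m m0 mu_m _ _ _ B Zs) => // [t t0|i mui]; last by rewrite Zb ?brho.
rewrite (le_trans (J_le _ _ _)) ?(le_trans (Y_le _ _ _))//.
by rewrite lerDl mulr_ge0// divr_ge0// ltW.
Qed.

(** Psi keeps the stable coordinates of a and replaces the unstable ones by the values that
    boundedness dictates; its fixed points form the graph. *)
Let Psi a := Y a 0.

Let DPsi a : 'M[R]_n := \matrix_i Z a (delta_mx 0 i) 0.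

(** Z a is linear in its direction by uniqueness: the combination of the solutions for the basis
    vectors solves the same equation with the same stable coordinates at 0. *)
Let DPsiE a h : `|a| <= r -> h *m DPsi a = Z a h 0.
Proof.
move=> ar.
pose z t : 'rV[R]_n := h *m (\matrix_i Z a (delta_mx 0 i) t).
have zE t : z t = \sum_i h 0 i *: Z a (delta_mx 0 i) t.
  by rewrite /z mulmx_sum_row; apply: eq_bigr => i _; rewrite rowK.
have [Zs Zb [B ZB]] := Z_P a h ar.
suff : forall t, 0 <= t -> z t = Z a h t by move=> /(_ 0 (lexx _)).
apply: (solves_uniq mu m m0 mu_m _ (fun t => z t *m J (Y a t)) _ _ (\sum_i `|h 0 i| * 1) B _ Zs) => //.
- move=> i t t0.
  have := @is_derive_sum _ _ _ n (fun k s => h 0 k * Z a (delta_mx 0 k) s 0 i) t 1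
    (fun k => h 0 k * (mu 0 i * Z a (delta_mx 0 k) t 0 i + (Z a (delta_mx 0 k) t *m J (Y a t)) 0 i)).
  have -> : \sum_(k < n) (fun s => h 0 k * Z a (delta_mx 0 k) s 0 i) = (fun s => z s 0 i).
    apply/funext => s; rewrite zE fct_sumE summxE.
    by apply: eq_bigr => k _; rewrite mxE.
  case=> [k|d e].
    have [Zk _ _] := Z_P a (delta_mx 0 k) ar.
    exact: is_deriveZ (Zk i t t0).
  apply: DeriveDef => //; rewrite e.
  rewrite !zE mulmx_suml !summxE mulr_sumr -big_split/=.
  by apply: eq_bigr => k _; rewrite -scalemxAl !mxE; ring.
- move=> t t0; rewrite zE (le_trans (ler_norm_sum _ _ _))//.
  apply: ler_sum => i _; rewrite normrZ ler_wpM2l//.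
  apply: Z_le => // k _; rewrite mxE/=.
  by case: eqP => _; rewrite /= ?normr1 ?normr0.
- by move=> t t0; rewrite -mulmxBl J_le// (le_trans (Y_le _ _ _)).
- move=> i mui; rewrite Zb// zE summxE (bigD1 i)//= big1 ?addr0 => [|k ki].
    by have [_ Zk _] := Z_P a (delta_mx 0 i) ar; rewrite mxE Zk// mxE !eqxx mulr1.
  have [_ Zk _] := Z_P a (delta_mx 0 k) ar; rewrite mxE Zk// mxE eqxx/= eq_sym.
  by rewrite (negPf ki) mulr0.
Qed.

(** Y a' - Y a - Z a (a' - a) solves the variational equation along Y a, up to a remainder of size C
    |a' - a|^2, and its stable coordinates vanish at 0. Then [solves_le] applies with m/2 rho equal
    to that remainder, whence the factor 2 / m. The difference of Z a' h and Z a h is treated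
    alike. *)
Let Psi_C11 : C11 (cball 0 r) (2 * C / m) Psi DPsi.
Proof.
have half (x : R) : C * x = m / 2 * (2 * C / m * x).
  by field; exact: lt0r_neq0.
split=> [a a'|a a' h]; rewrite /cball/= !subr0 => ar a'r.
  rewrite DPsiE//.
  have [Zs Zb [B ZB]] := Z_P a (a' - a) ar.
  have [B1 YB1] := Y_bounded a; have [B2 YB2] := Y_bounded a'.
  apply: (solves_le mu m m0 mu_m _ _ _ ((B2 + B1) + B)
    (solvesB _ _ _ _ _ (solvesB _ _ _ _ _ (Y_solves a') (Y_solves a)) Zs)) => // [t t0||t t0|i mui].
  - rewrite (le_trans (ler_normB _ _))// lerD ?ZB//.
    by rewrite (le_trans (ler_normB _ _))// lerD ?YB1 ?YB2.
  - by rewrite mulr_ge0 ?exprn_ge0// divr_ge0 ?(ltW m0)// mulr_ge0.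
  - have Ya := le_trans (Y_le a t t0) ar; have Ya' := le_trans (Y_le a' t t0) a'r.
    rewrite /Nc !clamp_id//.
    have -> : N (Y a' t) - N (Y a t) - Z a (a' - a) t *m J (Y a t) =
       (Y a' t - Y a t - Z a (a' - a) t) *m J (Y a t) +
       (N (Y a' t) - N (Y a t) - (Y a' t - Y a t) *m J (Y a t)).
      by rewrite [X in _ = X + _]mulmxBl [RHS]addrC subrKA.
    rewrite (le_trans (ler_normD _ _))// lerD ?J_le// -half.
    rewrite (le_trans (NJ.1 _ _ (in_ball _ Ya) (in_ball _ Ya')))// ler_wpM2l//.
    rewrite lerXn2r ?nnegrE//; apply: Y_dist => // i _.
    by have := rV_coord_le (a' - a) i; rewrite !mxE.
  - by rewrite !mxE Zb// !Y_stable// !mxE subrr normr0 mulr_ge0 ?exprn_ge0// divr_ge0 ?(ltW m0)// mulr_ge0.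
have rho0 : 0 <= 2 * C / m * `|a' - a| * `|h|.
  by rewrite !mulr_ge0// ?invr_ge0 ltW.
rewrite mulmxBr !DPsiE//.
have [Zs Zb [B ZB]] := Z_P a h ar; have [Zs' Zb' [B' ZB']] := Z_P a' h a'r.
apply: (solves_le mu m m0 mu_m _ _ _ (B' + B) (solvesB _ _ _ _ _ Zs' Zs)) => // [t t0|t t0|i mui].
- by rewrite (le_trans (ler_normB _ _))// lerD ?ZB ?ZB'.
- have Ya := le_trans (Y_le a t t0) ar; have Ya' := le_trans (Y_le a' t t0) a'r.
  have -> : Z a' h t *m J (Y a' t) - Z a h t *m J (Y a t) =
      (Z a' h t - Z a h t) *m J (Y a' t) + Z a h t *m (J (Y a' t) - J (Y a t)).
    by rewrite mulmxBl mulmxBr subrKA.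
  rewrite (le_trans (ler_normD _ _))// lerD ?J_le//.
  rewrite (le_trans (NJ.2 _ _ _ (in_ball _ Ya) (in_ball _ Ya')))//.
  rewrite -mulrA [leRHS]mulrA -half -mulrA ler_wpM2l// ler_pM//.
    by apply: Y_dist => // i _; have := rV_coord_le (a' - a) i; rewrite !mxE.
  by apply: Z_le => // i _; exact: rV_coord_le.
- by rewrite !mxE Zb// Zb'// subrr normr0.
Qed.

(** An orbit that stays in the box is a bounded solution of the truncated equation, hence equals Y a
    by uniqueness; conversely, if P a = a then Y a starts at a, stays in the box and decays. The
    vanishing rows of DP express that P ignores the unstable coordinates, and later give the rank of
    the defining function. *)
Lemma stable_graph : exists (P : 'rV[R]_n -> 'rV[R]_n) (DP : 'rV[R]_n -> 'M[R]_n),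
  [/\ C11 (cball 0 r) (2 * C / m) P DP,
    forall a i, mu 0 i < 0 -> P a 0 i = a 0 i,
    forall a i, `|a| <= r -> 0 <= mu 0 i -> row i (DP a) = 0 &
    forall rho a, rho <= r -> `|a| < rho ->
      local_stable_set (fun x => x *m diag_mx mu + N x) 0 [set x | `|x| < rho] a <->
      P a = a].
Proof.
have FE (x : 'rV[R]_n) i : (x *m diag_mx mu + N x) 0 i = mu 0 i * x 0 i + N x 0 i.
  by rewrite mxE mul_mx_diag mxE mulrC.
exists Psi, DPsi; split.
- exact: Psi_C11.
- exact: Y_stable.
- move=> a i ar mui; rewrite rowK; apply/eqP; rewrite -normr_le0.
  apply: Z_le => // k muk; rewrite mxE eqxx/=.
  case: eqP => [ki|_]; last by rewrite normr0.
  by move: muk; rewrite ki ltNge mui.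
move=> rho a rhor arho; split=> [[y [ya yd yU _]]|Pa].
  have yr t : 0 <= t -> `|y t| <= r by move=> /yU /ltW /le_trans; apply.
  have [B YB] := Y_bounded a.
  have ys : solves mu y (fun t => Nc (y t)).
    move=> i t t0; have := (is_derive_rV _ _ _).1 (yd t t0) i.
    by rewrite FE /Nc clamp_id ?yr.
  rewrite -[RHS]ya; apply: (solves_uniq mu m m0 mu_m _ _ _ _ B r (Y_solves a) ys) => //.
  by move=> i mui; rewrite Y_stable// ya.
have Ylt t : 0 <= t -> `|Y a t| < rho by move=> t0; exact: le_lt_trans (Y_le _ _ t0) arho.
exists (Y a); split => //.
- move=> t t0; apply/is_derive_rV => i; rewrite FE.
  have := Y_solves a i t t0; rewrite /Nc clamp_id//.
  by rewrite (le_trans (ltW (Ylt t t0))).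
- have [B YB] := Y_decay a.
  apply/cvgrPdist_le => e e0; near=> t.
  have t0 : 0 <= t by near: t; exact: nbhs_pinfty_ge.
  rewrite sub0r normrN (le_trans (YB _ t0))// (le_trans (ler_norm _))//.
  rewrite normrM [X in _ * X]ger0_norm ?expR_ge0// mulNr expRN.
  rewrite ler_pdivrMr ?expR_gt0//.
  (* From here on expR (m t), being at least 1 + m t, exceeds |B| / e. *)
  have : `|B| / e / m <= t by near: t; apply: nbhs_pinfty_ge; exact: num_real.
  rewrite ler_pdivrMr// ler_pdivrMr// => /le_trans; apply.
  rewrite mulrC ler_pM2l// mulrC (le_trans _ (expR_ge1Dx _))//; lra.
Unshelve. all: by end_near. Qed.

End lyapunov_perron.

(** * Calculus of fields with Lipschitz derivative *)

Lemma mulmx_bounded {R : realType} {n k : nat} (M : 'M[R]_(n, k)) :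
  exists2 K : R, 0 < K & forall h : 'rV[R]_n, `|h *m M| <= K * `|h|.
Proof.
exists (1 + \sum_i \sum_j `|M i j|) => [|h].
  by rewrite ltr_pwDl// sumr_ge0// => i _; rewrite sumr_ge0.
have K0 : 0 <= 1 + \sum_i \sum_j `|M i j|.
  by rewrite addr_ge0// sumr_ge0// => i _; rewrite sumr_ge0.
apply: rV_norm_le => [|j]; first by rewrite mulr_ge0.
rewrite mxE (le_trans (ler_norm_sum _ _ _))//.
rewrite mulrDl mul1r ler_wpDl// mulr_suml ler_sum// => i _.
rewrite normrM mulrC ler_pM// ?rV_coord_le//.
by rewrite (bigD1 j)//= lerDl sumr_ge0.
Qed.

Lemma mulmxr_continuous {R : realType} {n k : nat} (M : 'M[R]_(n, k)) :
  continuous (fun h : 'rV[R]_n => h *m M).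
Proof.
have [K K0 MK] := mulmx_bounded M.
move=> x; apply/(cvgrPdist_le (FF := nbhs_filter x)) => e e0.
have /cvgrPdist_le/(_ (e / K)) : z @[z --> x] --> x by exact: cvg_id.
rewrite divr_gt0// => /(_ isT); apply: filterS => z xz.
by rewrite -mulmxBl (le_trans (MK _))// mulrC -ler_pdivlMr.
Qed.

Lemma is_derive_mulmxr {R : realType} {n k : nat} (M : 'M[R]_(n, k))
    (y : R -> 'rV[R]_n) (t : R) (d : 'rV[R]_n) :
  is_derive t 1 y d -> is_derive t 1 (fun s => y s *m M) (d *m M).
Proof.
move=> /is_derive_rV yd; apply/is_derive_rV => j.
have H i : is_derive t 1 (fun s => M i j * y s 0 i) (M i j * d 0 i).
  exact: is_deriveZ (yd i).
have := is_derive_sum H.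
have -> : \sum_(i < n) (fun s => M i j * y s 0 i) = (fun s => (y s *m M) 0 j).
  by apply/funext => s; rewrite fct_sumE mxE; apply: eq_bigr => i _; rewrite mulrC.
move=> [h e].
by apply: DeriveDef => //; rewrite e mxE; apply: eq_bigr => i _; rewrite mulrC.
Qed.

Section C11_theory.
Context {R : realType} {n k : nat}.
Implicit Types (A : set 'rV[R]_n) (f : 'rV[R]_n -> 'rV[R]_k) (J : 'rV[R]_n -> 'M[R]_(n, k)).

Lemma C11_linear A (M : 'M[R]_(n, k)) : C11 A 0 (fun x => x *m M) (fun=> M).
Proof.
split=> [x x'|x x' h] _ _; last by rewrite subrr mulmx0 normr0 !mul0r.
by rewrite -mulmxBl subrr normr0 mul0r.
Qed.

Lemma C11B A C C' f J f' J' : C11 A C f J -> C11 A C' f' J' ->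
  C11 A (C + C') (fun x => f x - f' x) (fun x => J x - J' x).
Proof.
move=> [f1 f2] [f1' f2']; split=> [x x' Ax Ax'|x x' h Ax Ax'].
  have -> : f x' - f' x' - (f x - f' x) - (x' - x) *m (J x - J' x) =
    (f x' - f x - (x' - x) *m J x) - (f' x' - f' x - (x' - x) *m J' x).
    by rewrite mulmxBr; apply/rowP => i; rewrite !mxE; ring.
  by rewrite (le_trans (ler_normB _ _))// mulrDl lerD// ?f1 ?f1'.
have -> : J x' - J' x' - (J x - J' x) = (J x' - J x) - (J' x' - J' x).
  by apply/matrixP => i j; rewrite !mxE; ring.
by rewrite mulmxBr (le_trans (ler_normB _ _))// !mulrDl lerD// ?f2 ?f2'.
Qed.

(** A quadratic remainder is little-o of the increment, and uniqueness of the differential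
    identifies the abstract Jacobian with J x. *)
Lemma C11_is_diff A C f J x : C11 A C f J -> nbhs x A ->
  differentiable f x /\ 'J f x = J x.
Proof.
move=> [f1 _] Ax.
have Jc : continuous (mulmxr (J x) : {linear 'rV[R]_n -> 'rV[R]_k}).
  exact: mulmxr_continuous.
have e : f \o shift x = cst (f x) + (mulmxr (J x) : {linear 'rV[R]_n -> 'rV[R]_k}) +o_ 0 id.
  apply/eqaddoP => e e0.
  have : \forall h \near (0 : 'rV[R]_n), A (h + x) /\ `|C| * `|h| <= e.
    have Ah := (nbhsDl A 0 x).1 (eq_ind_r (fun z => nbhs z A) Ax (add0r x)).
    have Bh : \forall h \near (0 : 'rV[R]_n), `|h| <= e / (`|C| + 1).
      by apply: nbhs0_le; rewrite divr_gt0// ltr_wpDl.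
    apply: filterS2 Ah Bh => h Ah Bh; split => //; move: Bh.
    rewrite ler_pdivlMr ?ltr_wpDl// mulrDr mulr1 mulrC.
    by have := normr_ge0 h; lra.
  apply: filterS => h [Ah hC].
  have := f1 _ _ (nbhs_singleton Ax) Ah.
  rewrite addrK /= => h1; rewrite -[X in `|X|]/(f (h + x) - (f x + h *m J x)).
  rewrite opprD addrA (le_trans h1)// expr2 mulrA ler_wpM2r//.
  by rewrite (le_trans _ hC)// ler_wpM2r// ler_norm.
have du := diff_unique Jc e.
split; first by apply/diff_locallyP; rewrite du.
by apply/row_matrixP => i; rewrite !rowE /jacobian mul_rV_lin1 du.
Qed.

Lemma C11_jacobian_continuous A C f J x : open A -> A x -> C11 A C f J ->
  {for x, continuous (jacobian f)}.
Proof.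
move=> oA Ax fJ; have AA z : A z -> nbhs z A by move=> Az; exact: open_nbhs_nbhs.
have Jx z : A z -> 'J f z = J z by move=> /AA /(C11_is_diff _ _ _ _ _ fJ)[].
apply/(cvgrPdist_le (FF := nbhs_filter x)) => e e0; near=> z.
have Az : A z by near: z; exact: AA.
rewrite !Jx// [leLHS]/Num.Def.normr/= mx_normrE; apply: bigmax_le; first exact: ltW.
move=> -[i j] _ /=.
have : `|x - z| <= e / (`|C| + 1).
  near: z; have /cvgrPdist_le : z @[z --> x] --> x by exact: cvg_id.
  by apply; rewrite divr_gt0// ltr_wpDl.
rewrite ler_pdivlMr ?ltr_wpDl// mulrDr mulr1 mulrC => h.
(* The Lipschitz bound concerns the action on vectors; testing it on a basis vector gives the
   entries of row i. *)
have := fJ.2 _ _ (delta_mx 0 i) Az Ax.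
have d1 : `|delta_mx 0 i : 'rV[R]_n| <= 1.
  by apply: rV_norm_le => // l; rewrite mxE/=; case: eqP; rewrite /= ?normr0 ?normr1.
have -> : (J x - J z) i j = (row i (J x - J z)) 0 j by rewrite [RHS]mxE.
rewrite rowE.
move=> /(le_trans (rV_coord_le _ j)) /le_trans; apply.
have : C * `|x - z| * `|delta_mx 0 i : 'rV[R]_n| <= `|C| * `|x - z|.
  rewrite (le_trans (ler_norm _))// !normrM !normr_id -[leRHS]mulr1.
  by rewrite ler_wpM2l ?mulr_ge0.
by have := normr_ge0 (x - z); lra.
Unshelve. all: by end_near. Qed.

End C11_theory.

(** Used for the passage to eigencoordinates and, with T a selection of columns, for the function
    whose zeros are the stable set. *)
Lemma C11_affine {R : realType} {n' n k k' : nat} (A : set 'rV[R]_n) (C : R)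
    (f : 'rV[R]_n -> 'rV[R]_k) (J : 'rV[R]_n -> 'M[R]_(n, k))
    (a : 'rV[R]_n) (Q : 'M[R]_(n', n)) (T : 'M[R]_(k, k')) :
  0 <= C -> C11 A C f J ->
  exists2 C', 0 <= C' & C11 [set z | A (a + z *m Q)] C'
    (fun z => f (a + z *m Q) *m T) (fun z => Q *m J (a + z *m Q) *m T).
Proof.
move=> C0 [f1 f2]; have [KQ Q0 QK] := mulmx_bounded Q; have [KT T0 TK] := mulmx_bounded T.
exists (KT * C * KQ * KQ) => [|]; first by rewrite !mulr_ge0// ltW.
have aE z z' : a + z' *m Q - (a + z *m Q) = (z' - z) *m Q.
  by rewrite opprD addrACA subrr add0r mulmxBl.
split=> [x x' Ax Ax'|x x' h Ax Ax'].
  rewrite -mulmxBl !mulmxA -mulmxBl -aE (le_trans (TK _))//.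
  rewrite -!mulrA ler_pM2l// (le_trans (f1 _ _ Ax Ax'))// aE ler_wpM2l//.
  have -> : KQ * (KQ * `|x' - x| ^+ 2) = (KQ * `|x' - x|) ^+ 2 by ring.
  by rewrite lerXn2r ?nnegrE ?mulr_ge0 ?(ltW Q0)// QK.
rewrite -mulmxBl -mulmxBr !mulmxA (le_trans (TK _))//.
rewrite -!mulrA ler_pM2l// (le_trans (f2 _ _ _ Ax Ax'))// aE -mulrA ler_wpM2l//.
have -> : KQ * (KQ * (`|x' - x| * `|h|)) = (KQ * `|x' - x|) * (KQ * `|h|) by ring.
by rewrite ler_pM// QK.
Qed.

(** * Hyperbolic equilibria *)

Lemma C11S {R : realType} {n k : nat} (A B : set 'rV[R]_n) (C : R)
    (f : 'rV[R]_n -> 'rV[R]_k) (J : 'rV[R]_n -> 'M[R]_(n, k)) :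
  B `<=` A -> C11 A C f J -> C11 B C f J.
Proof.
move=> BA [f1 f2]; split=> [x x' /BA Ax /BA Ax'|x x' h /BA Ax /BA Ax'].
  exact: f1.
exact: f2.
Qed.

(** The inverse of 1 plus the sum of all |mu_i|^-1 lies below each |mu_i|; unlike a minimum, it also
    makes sense for n = 0. *)
Lemma nonzero_gap {R : realType} {n : nat} (mu : 'rV[R]_n) :
  (forall i, mu 0 i != 0) -> exists2 m : R, 0 < m & forall i, 2 * m <= `|mu 0 i|.
Proof.
move=> mu0; pose M : R := 1 + \sum_i `|mu 0 i|^-1.
have M0 : 0 < M by rewrite ltr_pwDl// sumr_ge0// => i _; rewrite invr_ge0.
exists (M^-1 / 2) => [|i]; first by rewrite divr_gt0 ?invr_gt0.
rewrite mulrC divfK// -[leRHS]invrK lef_pV2 ?posrE ?invr_gt0 ?normr_gt0//.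
rewrite /M (bigD1 i)//= addrCA lerDl addr_ge0// sumr_ge0// => j _; rewrite invr_ge0.
Qed.

Lemma cvg_mulmxr {R : realType} {T : Type} {n k : nat} (F : set_system T)
    {FF : Filter F} (y : T -> 'rV[R]_n) (a : 'rV[R]_n) (M : 'M[R]_(n, k)) :
  y t @[t --> F] --> a -> y t *m M @[t --> F] --> a *m M.
Proof. by move=> ya; exact: (@cvg_comp _ _ _ y (fun x => x *m M) _ _ _ ya (mulmxr_continuous M a)). Qed.

Section straightening.
Context {R : realType} {n : nat}.
Variables (F G : 'rV[R]_n -> 'rV[R]_n) (p : 'rV[R]_n) (P : 'M[R]_n).
Hypothesis P_unit : P \in unitmx.
Hypothesis FG : forall w, G w = F (p + w *m P) *m invmx P.

(** Affine conjugation carries orbits to orbits in both directions. The neighborhood of p is a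
    parallelepiped along the eigenvectors, so that its image is a sup-norm ball. *)
Lemma local_stable_set_straighten (rho : R) (z : 'rV[R]_n) :
  local_stable_set F p [set z | `|(z - p) *m invmx P| < rho] z <->
  local_stable_set G 0 [set w | `|w| < rho] ((z - p) *m invmx P).
Proof.
pose Q := invmx P.
have zK x : p + (x - p) *m Q *m P = x by rewrite mulmxKV// addrC subrK.
have wK w : (p + w *m P - p) *m Q = w by rewrite addrC addKr mulmxK.
split=> [[y [y0 yd yU yp]]|[y [y0 yd yU yp]]].
  exists (fun t => (y t - p) *m Q); split.
  - by rewrite y0.
  - move=> t t0; rewrite FG zK; apply: is_derive_mulmxr.
    have := is_deriveB (yd t t0) (is_derive_cst p t 1).
    by move/is_derive_eq; apply; rewrite subr0.
  - by move=> t t0; exact: yU.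
  - have <- : (p - p) *m Q = 0 by rewrite subrr mul0mx.
    apply: cvg_mulmxr; apply: cvgB; [exact: yp|exact: cvg_cst].
exists (fun t => p + y t *m P); split.
- by rewrite y0 zK.
- move=> t t0.
  have := is_deriveD (is_derive_cst p t 1) (is_derive_mulmxr P _ _ _ (yd t t0)).
  by move/is_derive_eq; apply; rewrite add0r FG mulmxKV.
- by move=> t t0; rewrite /= wK; exact: yU.
- rewrite -[X in _ --> X]addr0 -(mul0mx _ P).
  by apply: cvgD; [exact: cvg_cst|exact: cvg_mulmxr yp].
Qed.

End straightening.

Section hyperbolic_equilibrium.
Context {R : realType} {n : nat}.
Variables (F : 'rV[R]_n -> 'rV[R]_n) (J : 'rV[R]_n -> 'M[R]_n) (p : 'rV[R]_n).
Variables (r C : R) (P : 'M[R]_n) (mu : 'rV[R]_n).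
Hypotheses (r0 : 0 < r) (C0 : 0 <= C) (FJ : C11 (cball p r) C F J).
Hypotheses (Fp : F p = 0) (P_unit : P \in unitmx).
Hypothesis PJ : P *m J p = diag_mx mu *m P.
Hypothesis mu_neq0 : forall i, mu 0 i != 0.

Let Q := invmx P.
Let box (rho : R) : set 'rV[R]_n := [set z | `|(z - p) *m Q| < rho].

Lemma local_stable_graph : exists (rho K : R) (S : 'rV[R]_n -> 'rV[R]_n)
    (DS : 'rV[R]_n -> 'M[R]_n),
  [/\ 0 < rho, 0 <= K & C11 (cball 0 rho) K S DS] /\
  [/\ forall a i, mu 0 i < 0 -> S a 0 i = a 0 i,
    forall a i, `|a| <= rho -> 0 <= mu 0 i -> row i (DS a) = 0 &
    forall e z, e <= rho -> box e z ->
      local_stable_set F p (box e) z <-> S ((z - p) *m Q) = (z - p) *m Q].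
Proof.
have [m m0 mu_ge] := nonzero_gap mu mu_neq0.
have [C1 C10 FJ1] := C11_affine _ _ _ _ p P Q C0 FJ.
pose N w := F (p + w *m P) *m Q - w *m diag_mx mu.
pose JN w := P *m J (p + w *m P) *m Q - diag_mx mu.
have [KP KP0 PK] := mulmx_bounded P.
(* The first term keeps the image of the ball inside the domain of [FJ]; the second gives 3 C1 rho
   <= m / 2, its + 1 keeping the denominator positive when C1 = 0. *)
pose rho := Num.min (r / KP) (m / (6 * C1 + 1)).
have rho0 : 0 < rho by rewrite lt_min !divr_gt0// ltr_wpDl// mulr_ge0.
have NJ : C11 (cball 0 rho) C1 N JN.
  rewrite -[C1]addr0; apply: C11B; last exact: C11_linear.
  apply: C11S FJ1 => w; rewrite /cball/= subr0 => wrho.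
  rewrite addrC addKr (le_trans (PK _))// mulrC -ler_pdivlMr//.
  by rewrite (le_trans wrho)// ge_min lexx.
have N0 : N 0 = 0 by rewrite /N !mul0mx addr0 Fp mul0mx subr0.
have J0 : JN 0 = 0 by rewrite /JN mul0mx addr0 PJ mulmxK// subrr.
have rho_m : 3 * C1 * rho <= m / 2.
  have : rho <= m / (6 * C1 + 1) by rewrite ge_min lexx orbT.
  rewrite ler_pdivlMr; last by rewrite ltr_wpDl// mulr_ge0.
  by have := rho0; have := mulr_ge0 C10 (ltW rho0); lra.
have [S [DS [SC Ss Su SE]]] :=
  stable_graph mu m C1 rho N JN m0 mu_ge rho0 C10 rho_m NJ N0 J0.
exists rho, (2 * C1 / m), S, DS; split; split => //.
  by rewrite divr_ge0 ?(ltW m0)// mulr_ge0.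
move=> e z erho ze; apply: iff_trans (SE _ _ erho ze).
apply: local_stable_set_straighten => // w.
by rewrite /N addrC subrK.
Qed.

Let box_open e : open (box e).
Proof.
have [K K0 QK] := mulmx_bounded Q.
rewrite openE => z; rewrite /box/= -subr_gt0 => zb; apply/nbhs_ballP.
exists ((e - `|(z - p) *m Q|) / K) => [|x]; first exact: divr_gt0.
rewrite -ball_normE/= ltr_pdivlMr// mulrC => zx.
have -> : x - p = (z - p) - (z - x) by apply/rowP => i; rewrite !mxE; ring.
rewrite mulmxBl (le_lt_trans (ler_normB _ _))//.
by have := QK (z - x); lra.
Qed.

Let box_center e : 0 < e -> box e p.
Proof. by move=> e0; rewrite /box/= subrr mul0mx normr0. Qed.

(** Without unstable coordinates S is the identity, so the stable set of every small box is the
    whole box. *)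
Lemma hyperbolic_local_attractor : (forall i, mu 0 i < 0) -> local_attractor F p.
Proof.
move=> mun; split=> // U /nbhs_ballP[e /= e0 eU].
have [rho [K [S [DS [[rho0 _ _] [Ss _ SE]]]]]] := local_stable_graph.
have [KP KP0 PK] := mulmx_bounded P.
pose d := Num.min rho (e / KP).
have d0 : 0 < d by rewrite lt_min rho0 divr_gt0.
have dU : box d `<=` U.
  move=> z zd; apply: eU; rewrite -ball_normE/= distrC.
  rewrite -[z - p](mulmxKV P_unit) (le_lt_trans (PK _))// mulrC -ltr_pdivlMr//.
  by rewrite (lt_le_trans zd)// ge_min lexx orbT.
have : nbhs p (box d) by apply: open_nbhs_nbhs; split; [exact: box_open|exact: box_center].
apply: filterS => z zd.
have [y [y0 yd yU yp]] : local_stable_set F p (box d) z.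
  apply/SE => //; first by rewrite ge_min lexx.
  by apply/rowP => i; exact: Ss.
by exists y; split => // t t0; exact/dU/yU.
Qed.

(** The defining function consists of the unstable coordinates of w - S w, where w stands for the
    eigencoordinates of z - p. *)
Lemma hyperbolic_stable_manifold (d : nat) :
  #|[pred i | mu 0 i < 0]| = d -> has_stable_manifold F p d.
Proof.
move=> dE.
have dn : (d <= n)%N by rewrite -dE (leq_trans (max_card _))// card_ord.
have uE : (n - d)%N = #|[pred i | 0 < mu 0 i]|.
  rewrite -dE -{1}(card_ord n) -(cardC [pred i | mu 0 i < 0]) addKn.
  by apply: eq_card => i; rewrite !inE -leNgt lt_def mu_neq0.
pose u (j : 'I_(n - d)) : 'I_n := enum_val (cast_ord uE j).
have u_gt0 j : 0 < mu 0 (u j) by have := enum_valP (cast_ord uE j); rewrite inE.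
have u_inj : injective u by move=> j k /enum_val_inj /cast_ord_inj.
have u_surj i : 0 < mu 0 i -> exists j, u j = i.
  move=> mui; have iA : i \in [pred i | 0 < mu 0 i] by [].
  exists (cast_ord (esym uE) (enum_rank_in iA i)).
  by rewrite /u cast_ordKV enum_rankK_in.
have [rho [K [S [DS [[rho0 K0 SC] [Ss Su SE]]]]]] := local_stable_graph.
exists (box rho); split; [exact: box_open|exact: box_center|split => // z0 Mz0].
pose T : 'M[R]_(n, n - d) := colsub u 1%:M.
have TE k (M : 'M[R]_(k, n)) : M *m T = colsub u M by rewrite mulmx_colsub mulmx1.
have idSC : C11 (cball 0 rho) (0 + K) (fun w => w *m 1%:M - S w) (fun w => 1%:M - DS w).
  by apply: C11B => //; exact: C11_linear.
have [C' C'0] := C11_affine _ _ _ _ (- (p *m Q)) Q T (addr_ge0 (lexx 0) K0) idSC.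
set g := fun z => _ *m T; set Jg := fun z => _ *m T => gC.
have wE z : - (p *m Q) + z *m Q = (z - p) *m Q by rewrite mulmxBl addrC.
have {}gC : C11 (box rho) C' g Jg.
  apply: C11S gC => z; rewrite /cball/= subr0 wE; exact: ltW.
have box_nbhs z : box rho z -> nbhs z (box rho).
  by move=> zb; apply: open_nbhs_nbhs; split => //; exact: box_open.
have gD z : box rho z -> differentiable g z /\ 'J g z = Jg z.
  by move=> /box_nbhs; exact: C11_is_diff gC.
exists (box rho), g; split => //.
- by case: Mz0 => y [<- _ yU _]; exact: yU.
- move=> z zb; split; first by have [] := gD z zb.
  exact: C11_jacobian_continuous (box_open _) zb gC.
- move=> z zb; have [_ ->] := gD z zb.
  (* The unstable rows of P furnish a left inverse: DS vanishes along these directions, so only the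
     identity part remains. *)
  apply/eqP/row_fullP; exists (rowsub u 1%:M *m P).
  rewrite /Jg !mulmxA mulmxK// mulmxBr mulmx1 TE.
  have -> : rowsub u 1%:M *m DS (- (p *m Q) + z *m Q) = 0.
    rewrite mul_rowsub_mx mul1mx; apply/row_matrixP => j.
    rewrite row_rowsub Su ?row0 ?(ltW (u_gt0 _))//.
    by rewrite wE; exact: ltW.
  rewrite subr0; apply/matrixP => j k; rewrite !mxE.
  by rewrite (inj_eq u_inj).
- apply/seteqP; split=> z [Mz zb]; split => //; move: Mz.
    move=> /SE SEz; rewrite /= /g wE mulmx1 SEz// subrr mul0mx//.
  rewrite /= /g wE mulmx1 TE => gz; apply/SE => //.
  apply/rowP => i; have [mui|mui|mui] := ltgtP (mu 0 i) 0.
  + exact: Ss.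
  + have [j <-] := u_surj i mui.
    move/rowP : gz => /(_ j); rewrite !mxE => /eqP; rewrite subr_eq0 => /eqP/esym; exact.
  + by have := mu_neq0 i; rewrite mui eqxx.
Qed.

Lemma hyperbolic_jacobian : 'J F p = J p.
Proof.
have [] // := C11_is_diff _ _ _ _ p FJ.
apply/nbhs_ballP; exists r => // z.
by rewrite -ball_normE/= distrC /cball/=; exact: ltW.
Qed.

Lemma hyperbolic_eigenvalue_counts : eigenvalue_counts F p
  #|[pred i | mu 0 i < 0]| #|[pred i | 0 < mu 0 i]|.
Proof.
exists [seq mu 0 i | i <- enum 'I_n]; split.
- rewrite hyperbolic_jacobian big_map big_enum/=.
  transitivity (char_poly (diag_mx mu)); last first.
    rewrite char_poly_trig; last exact/diag_mx_is_trig.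
    by apply: eq_bigr => i _; rewrite mxE eqxx mulr1n.
  have JE : J p = Q *m diag_mx mu *m P by rewrite -mulmxA -PJ mulKmx.
  rewrite /char_poly.
  have PQ : map_mx polyC Q *m map_mx polyC P = 1%:M.
    by rewrite -map_mxM mulVmx// map_mx1.
  (* Similarity of the Jacobian to its diagonal form, lifted to matrices over polynomials so that
     determinants can be compared. *)
  have -> : char_poly_mx (J p) =
      map_mx polyC Q *m char_poly_mx (diag_mx mu) *m map_mx polyC P.
    rewrite /char_poly_mx mulmxBr mulmxBl JE !map_mxM; congr (_ - _).
    by rewrite scalar_mxC -mulmxA PQ mulmx1.
  by rewrite !det_mulmx mulrAC -det_mulmx PQ det1 mul1r.
- by rewrite count_map enumT cardE size_filter; apply: eq_count => i.
- by rewrite count_map enumT cardE size_filter; apply: eq_count => i.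
Qed.

End hyperbolic_equilibrium.

Lemma local_unstable_set_reverse {R : realType} {n : nat}
    (F : 'rV[R]_n -> 'rV[R]_n) (p : 'rV[R]_n) (U : set 'rV[R]_n) :
  local_unstable_set F p U = local_stable_set (fun z => - F z) p U.
Proof.
have rev (y : R -> 'rV[R]_n) (t : R) d :
    is_derive (- t) 1 y d -> is_derive t 1 (fun s => y (- s)) (- d).
  move=> /is_derive_rV yd; apply/is_derive_rV => i.
  have := is_derive1_comp (yd i) (is_deriveNid t 1).
  by move/is_derive_eq; apply; rewrite !mxE mulrN1.
apply/seteqP; split=> x [y [y0 yd yU yp]]; exists (fun t => y (- t)); split.
- by rewrite oppr0.
- by move=> t t0; apply/rev/yd; rewrite oppr_le0.
- by move=> t t0; apply: yU; rewrite oppr_le0.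
- by have /cvgNy_compNP := yp.
- by rewrite oppr0.
- move=> t t0; rewrite -[F _]opprK; apply/rev/yd; rewrite oppr_ge0//.
- by move=> t t0; apply: yU; rewrite oppr_ge0.
- by have /cvgy_compNP := yp.
Qed.

Lemma hyperbolic_unstable_manifold {R : realType} {n : nat}
    (F : 'rV[R]_n -> 'rV[R]_n) (J : 'rV[R]_n -> 'M[R]_n) (p : 'rV[R]_n)
    (r C : R) (P : 'M[R]_n) (mu : 'rV[R]_n) (d : nat) :
  0 < r -> 0 <= C -> C11 (cball p r) C F J -> F p = 0 -> P \in unitmx ->
  P *m J p = diag_mx mu *m P -> (forall i, mu 0 i != 0) ->
  #|[pred i | 0 < mu 0 i]| = d -> has_unstable_manifold F p d.
Proof.
move=> r0 C0 FJ Fp Pu PJ mu0 dE.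
suff [U [oU Up M]] : has_stable_manifold (fun z => - F z) p d.
  by exists U; split => //; rewrite local_unstable_set_reverse.
apply: (hyperbolic_stable_manifold _ (fun z => - J z) _ r (0 + C) P (- mu)) => //.
- by rewrite add0r.
(* The reversed field is written as the zero linear map minus F, which explains the constant 0 +
   C. *)
- have := C11B _ _ _ _ _ _ _ (C11_linear (cball p r) 0) FJ.
  have -> : (fun x => x *m 0 - F x) = (fun z => - F z).
    by apply/funext => z; rewrite mulmx0 sub0r.
  by have -> : (fun x => 0 - J x) = (fun z => - J z) by apply/funext => z; rewrite sub0r.
- by rewrite Fp oppr0.
- by rewrite mulmxN PJ -mulNmx -linearN.
- by move=> i; rewrite mxE oppr_eq0.
- by rewrite -dE; apply: eq_card => i; rewrite !inE mxE oppr_lt0.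
Qed.

(** A positive eigenvalue differs from every rate but the i-th, so the eigencoordinates of its
    eigenvector vanish off i. *)
Lemma hyperbolic_unstable_direction {R : realType} {n : nat}
    (F : 'rV[R]_n -> 'rV[R]_n) (J : 'rV[R]_n -> 'M[R]_n) (p : 'rV[R]_n)
    (r C : R) (P : 'M[R]_n) (mu : 'rV[R]_n) (i : 'I_n) (v : 'rV[R]_n) :
  0 < r -> C11 (cball p r) C F J -> P \in unitmx ->
  P *m J p = diag_mx mu *m P -> 0 < mu 0 i -> (forall k, k != i -> mu 0 k < 0) ->
  unstable_direction F p v <-> exists2 c : R, c != 0 & v = c *: row i P.
Proof.
move=> r0 FJ Pu PJ mui muk; rewrite /unstable_direction (hyperbolic_jacobian _ _ _ _ _ r0 FJ).
split=> [[v0 [l l0 vl]]|[c c0 ->]].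
  pose w := v *m invmx P.
  have vE : v = w *m P by rewrite /w mulmxKV.
  have wl : w *m diag_mx mu = l *: w.
    apply: (can_inj (mulmxK Pu)); rewrite -mulmxA -PJ mulmxA -vE vl.
    by rewrite vE scalemxAl.
  have wk k : k != i -> w 0 k = 0.
    move=> ki; move/rowP : wl => /(_ k); rewrite mul_mx_diag !mxE => /eqP.
    rewrite mulrC -subr_eq0 -mulrBl mulf_eq0 => /orP[|/eqP//].
    by have := muk _ ki; have := l0; rewrite subr_eq0 => ? ? /eqP; lra.
  have wE : v = w 0 i *: row i P.
    by rewrite {1}vE mulmx_sum_row (bigD1 i)//= big1 ?addr0// => k /wk ->; rewrite scale0r.
  exists (w 0 i) => //; apply: contraNneq v0 => wi0.
  by rewrite wE wi0 scale0r.
have ri : row i P *m J p = mu 0 i *: row i P.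
  by rewrite -row_mul PJ row_mul row_diag_mx -scalemxAl -rowE.
split; last by exists (mu 0 i) => //; rewrite -scalemxAl ri !scalerA mulrC.
rewrite scaler_eq0 negb_or c0/=; apply/eqP => ri0.
have : row i P *m invmx P = 0 by rewrite ri0 mul0mx.
rewrite -row_mul mulmxV// => /rowP/(_ i); rewrite !mxE eqxx => /eqP.
by rewrite oner_eq0.
Qed.

(** * Lipschitz-derivative bounds for polynomials *)

Section tame_functions.
Context {R : realType} {n : nat}.
Variable A : set 'rV[R]_n.
Implicit Types (f g : 'rV[R]_n -> R) (D E : 'rV[R]_n -> 'rV[R]_n -> R).

(** D x h plays the derivative of f at x along h. To the two estimates of [C11] are added bounds on
    f and D and a Lipschitz bound on f, without which the class would not be closed under
    products. *)
Definition tame f D := exists2 C : R, 0 <= C &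
  [/\ forall x, A x -> `|f x| <= C,
    forall x h, A x -> `|D x h| <= C * `|h|,
    forall x x', A x -> A x' -> `|f x' - f x| <= C * `|x' - x|,
    forall x x', A x -> A x' -> `|f x' - f x - D x (x' - x)| <= C * `|x' - x| ^+ 2 &
    forall x x' h, A x -> A x' -> `|D x' h - D x h| <= C * `|x' - x| * `|h|].

Lemma tame_coord (B : R) i : (forall x, A x -> `|x| <= B) ->
  tame (fun x => x 0 i) (fun _ h => h 0 i).
Proof.
move=> AB; exists (1 + `|B|) => //.
have B1 (c : R) : 0 <= c -> c <= (1 + `|B|) * c.
  by move=> c0; rewrite mulrDl mul1r lerDl mulr_ge0.
split=> [x Ax|x h _|x x' _ _|x x' _ _|x x' h _ _].
- rewrite (le_trans (rV_coord_le _ _))// (le_trans (AB _ Ax))//.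
  by rewrite (le_trans (ler_norm _))// lerDr.
- by rewrite (le_trans (rV_coord_le _ _))// B1.
- by have := rV_coord_le (x' - x) i; rewrite !mxE => /le_trans; apply; exact: B1.
- by rewrite !mxE subrr normr0 mulr_ge0 ?exprn_ge0.
- by rewrite subrr normr0 !mulr_ge0.
Qed.

Lemma tameZ c f D : tame f D -> tame (fun x => c * f x) (fun x h => c * D x h).
Proof.
move=> [C C0 [f1 f2 f3 f4 f5]]; exists (`|c| * C); first by rewrite mulr_ge0.
split=> [x Ax|x h Ax|x x' Ax Ax'|x x' Ax Ax'|x x' h Ax Ax'].
- by rewrite normrM ler_wpM2l// f1.
- by rewrite normrM -mulrA ler_wpM2l// f2.
- by rewrite -mulrBr normrM -mulrA ler_wpM2l// f3.
- by rewrite -!mulrBr normrM -mulrA ler_wpM2l// f4.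
- by rewrite -mulrBr normrM -!mulrA ler_wpM2l// mulrA f5.
Qed.

Lemma tameD f D g E : tame f D -> tame g E ->
  tame (fun x => f x + g x) (fun x h => D x h + E x h).
Proof.
move=> [C C0 [f1 f2 f3 f4 f5]] [C' C0' [g1 g2 g3 g4 g5]].
exists (C + C'); first by rewrite addr_ge0.
have tri (a b a' b' : R) : `|a| <= a' -> `|b| <= b' -> `|a + b| <= a' + b'.
  by move=> aa bb; rewrite (le_trans (ler_normD _ _))// lerD.
split=> [x Ax|x h Ax|x x' Ax Ax'|x x' Ax Ax'|x x' h Ax Ax']; rewrite ?mulrDl.
- by apply: tri; auto.
- by apply: tri; auto.
- by rewrite opprD addrACA; apply: tri; auto.
- have -> : f x' + g x' - (f x + g x) - (D x (x' - x) + E x (x' - x)) =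
    (f x' - f x - D x (x' - x)) + (g x' - g x - E x (x' - x)) by ring.
  by apply: tri; auto.
- by rewrite opprD addrACA; apply: tri; auto.
Qed.

Lemma tameM f D g E : tame f D -> tame g E ->
  tame (fun x => f x * g x) (fun x h => f x * E x h + g x * D x h).
Proof.
move=> [a a0 [f1 f2 f3 f4 f5]] [b b0 [g1 g2 g3 g4 g5]].
(* The last of the five estimates splits into four products, each bounded with constant a b; the
   others need at most three. *)
exists (4 * (a * b)); first by rewrite !mulr_ge0.
have ab := mulr_ge0 a0 b0.
have prod (u v u' v' w : R) : `|u| <= u' -> `|v| <= v' -> u' * v' = w -> `|u * v| <= w.
  by move=> uu vv <-; rewrite normrM ler_pM.
split=> [x Ax|x h Ax|x x' Ax Ax'|x x' Ax Ax'|x x' h Ax Ax'].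
- have := prod _ _ _ _ _ (f1 _ Ax) (g1 _ Ax) erefl; lra.
- have h0 := mulr_ge0 ab (normr_ge0 h).
  have h1 : `|f x * E x h| <= a * b * `|h| by apply: prod (f1 _ Ax) (g2 _ h Ax) _; ring.
  have h2 : `|g x * D x h| <= a * b * `|h| by apply: prod (g1 _ Ax) (f2 _ h Ax) _; ring.
  by have := ler_normD (f x * E x h) (g x * D x h); lra.
- have h0 := mulr_ge0 ab (normr_ge0 (x' - x)).
  have h1 : `|f x' * (g x' - g x)| <= a * b * `|x' - x|.
    by apply: prod (f1 _ Ax') (g3 _ _ Ax Ax') _; ring.
  have h2 : `|g x * (f x' - f x)| <= a * b * `|x' - x|.
    by apply: prod (g1 _ Ax) (f3 _ _ Ax Ax') _; ring.
  have -> : f x' * g x' - f x * g x = f x' * (g x' - g x) + g x * (f x' - f x) by ring.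
  by have := ler_normD (f x' * (g x' - g x)) (g x * (f x' - f x)); lra.
- set d := x' - x.
  have h0 := mulr_ge0 ab (exprn_ge0 2 (normr_ge0 d)).
  have h1 : `|f x * (g x' - g x - E x d)| <= a * b * `|d| ^+ 2.
    by apply: prod (f1 _ Ax) (g4 _ _ Ax Ax') _; ring.
  have h2 : `|g x * (f x' - f x - D x d)| <= a * b * `|d| ^+ 2.
    by apply: prod (g1 _ Ax) (f4 _ _ Ax Ax') _; ring.
  have h3 : `|(f x' - f x) * (g x' - g x)| <= a * b * `|d| ^+ 2.
    by apply: prod (f3 _ _ Ax Ax') (g3 _ _ Ax Ax') _; ring.
  have -> : f x' * g x' - f x * g x - (f x * E x d + g x * D x d) =
    f x * (g x' - g x - E x d) + g x * (f x' - f x - D x d) +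
    (f x' - f x) * (g x' - g x) by ring.
  rewrite (le_trans (ler_normD _ _))//.
  have := ler_normD (f x * (g x' - g x - E x d)) (g x * (f x' - f x - D x d)); lra.
- set d := x' - x.
  have h0 := mulr_ge0 ab (mulr_ge0 (normr_ge0 d) (normr_ge0 h)).
  have h1 : `|f x' * (E x' h - E x h)| <= a * b * (`|d| * `|h|).
    by apply: prod (f1 _ Ax') (g5 _ _ h Ax Ax') _; ring.
  have h2 : `|g x' * (D x' h - D x h)| <= a * b * (`|d| * `|h|).
    by apply: prod (g1 _ Ax') (f5 _ _ h Ax Ax') _; ring.
  have h3 : `|(f x' - f x) * E x h| <= a * b * (`|d| * `|h|).
    by apply: prod (f3 _ _ Ax Ax') (g2 _ h Ax) _; ring.
  have h4 : `|(g x' - g x) * D x h| <= a * b * (`|d| * `|h|).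
    by apply: prod (g3 _ _ Ax Ax') (f2 _ h Ax) _; ring.
  have -> : f x' * E x' h + g x' * D x' h - (f x * E x h + g x * D x h) =
    (f x' * (E x' h - E x h) + g x' * (D x' h - D x h)) +
    ((f x' - f x) * E x h + (g x' - g x) * D x h) by ring.
  rewrite (le_trans (ler_normD _ _))//.
  have := ler_normD (f x' * (E x' h - E x h)) (g x' * (D x' h - D x h)).
  have := ler_normD ((f x' - f x) * E x h) ((g x' - g x) * D x h); lra.
Qed.

Lemma tame_C11 k (F : 'rV[R]_n -> 'rV[R]_k) (J : 'rV[R]_n -> 'M[R]_(n, k)) :
  (forall j, tame (fun x => F x 0 j) (fun x h => (h *m J x) 0 j)) ->
  exists2 C, 0 <= C & C11 A C F J.
Proof.
move=> FJ.
have : forall j : 'I_k, exists C, 0 <= C /\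
    (forall x x', A x -> A x' ->
      `|F x' 0 j - F x 0 j - ((x' - x) *m J x) 0 j| <= C * `|x' - x| ^+ 2) /\
    (forall x x' (h : 'rV[R]_n), A x -> A x' ->
      `|(h *m J x') 0 j - (h *m J x) 0 j| <= C * `|x' - x| * `|h|).
  by move=> j; have [C C0 [_ _ _ f4 f5]] := FJ j; exists C.
move=> /choice[c cP].
have c0 : 0 <= \sum_(j < k) c j by apply: sumr_ge0 => j _; have [] := cP j.
have cle (j : 'I_k) : c j <= \sum_(j < k) c j.
  by rewrite (bigD1 j)//= lerDl sumr_ge0// => l _; have [] := cP l.
exists (\sum_(j < k) c j) => //; split=> [x x' Ax Ax'|x x' h Ax Ax'].
  apply: rV_norm_le => [|j]; first by rewrite mulr_ge0 ?exprn_ge0.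
  have [_ [f4 _]] := cP j.
  have -> : (F x' - F x - (x' - x) *m J x) 0 j =
    F x' 0 j - F x 0 j - ((x' - x) *m J x) 0 j by rewrite !mxE.
  by rewrite (le_trans (f4 _ _ Ax Ax'))// ler_wpM2r ?exprn_ge0.
apply: rV_norm_le => [|j]; first by rewrite !mulr_ge0.
have [_ [_ f5]] := cP j.
have -> : (h *m (J x' - J x)) 0 j = (h *m J x') 0 j - (h *m J x) 0 j.
  by rewrite mulmxBr !mxE.
by rewrite (le_trans (f5 _ _ _ Ax Ax'))// -!mulrA ler_wpM2r ?mulr_ge0.
Qed.

End tame_functions.

(** * The reduced system and its rolls *)

Lemma tame_ext {R : realType} {n : nat} (A : set 'rV[R]_n) f D f' D' :
  (forall x, f x = f' x) -> (forall x h, D x h = D' x h) ->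
  tame A f D -> tame A f' D'.
Proof.
move=> ff DD; have -> : f = f' by exact/funext.
by have -> : D = D' by apply/funext => x; exact/funext.
Qed.

Lemma row3E {R : realType} (a b c : R) :
  [/\ row3 a b c 0 0 = a, row3 a b c 0 1 = b & row3 a b c 0 2 = c].
Proof. by rewrite !mxE. Qed.

Definition rows3 {R : realType} (u v w : 'rV[R]_3) : 'M[R]_3 :=
  \matrix_(i < 3) nth 0 [:: u; v; w] i.

Lemma rV3P {R : realType} (u v : 'rV[R]_3) :
  u 0 0 = v 0 0 -> u 0 1 = v 0 1 -> u 0 2 = v 0 2 -> u = v.
Proof.
move=> h0 h1 h2; apply/rowP => -[[|[|[|//]]] i].
- by rewrite (_ : Ordinal i = 0) //; exact/val_inj.
- by rewrite (_ : Ordinal i = 1) //; exact/val_inj.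
- by rewrite (_ : Ordinal i = 2) //; exact/val_inj.
Qed.

Lemma mulmx_rows3 {R : realType} (h u v w : 'rV[R]_3) :
  h *m rows3 u v w = h 0 0 *: u + h 0 1 *: v + h 0 2 *: w.
Proof.
rewrite mulmx_sum_row !big_ord_recl big_ord0 addr0 !rowK/= addrA.
by congr (_ *: _ + _ *: _ + _ *: _); congr (h 0 _); exact/val_inj.
Qed.

Lemma rows3_mulmx {R : realType} (u v w u' v' w' : 'rV[R]_3) (M : 'M[R]_3) :
  u *m M = u' -> v *m M = v' -> w *m M = w' ->
  rows3 u v w *m M = rows3 u' v' w'.
Proof.
move=> <- <- <-; apply/row_matrixP => i; rewrite row_mul !rowK.
by case: i => -[|[|[|//]]].
Qed.

Lemma diag_mx_rows3 {R : realType} (a b c : R) (u v w : 'rV[R]_3) :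
  diag_mx (row3 a b c) *m rows3 u v w = rows3 (a *: u) (b *: v) (c *: w).
Proof.
apply/row_matrixP => i; rewrite row_mul row_diag_mx -scalemxAl -rowE !rowK mxE.
by case: i => -[|[|[|//]]].
Qed.

Lemma rows3_1 {R : realType} : rows3 (row3 1 0 0) (row3 0 1 0) (row3 0 0 1) = 1%:M :> 'M[R]_3.
Proof.
by apply/matrixP => -[[|[|[|//]]] i] -[[|[|[|//]]] j]; rewrite !mxE/= ?mxE.
Qed.

Lemma card_ord3 (P : pred 'I_3) : #|P| = (P 0%R + P 1%R + P 2%R)%N.
Proof.
rewrite -sum1_card big_mkcond/= !big_ord_recl big_ord0 addn0 addnA !unfold_in.
have -> : lift ord0 ord0 = 1 :> 'I_3 by exact/val_inj.
have -> : lift ord0 (lift ord0 ord0) = 2 :> 'I_3 by exact/val_inj.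
by do 3 case: (P _).
Qed.

Section reduced_system.
Context {R : realType}.
Variables beta xi eta tau : R.
Let F := reduced_field beta xi eta tau.

(** The matrix is symmetric, the field being a gradient, so row and column conventions agree
    here. *)
Definition reduced_jacobian (y : 'rV[R]_3) : 'M[R]_3 :=
  let a := y 0 0 in let b := y 0 1 in let c := y 0 2 in
  let d u v w := beta + 3 * xi * u ^+ 2 + eta * v ^+ 2 + eta * w ^+ 2 in
  let o u v w := 2 * eta * u * v + tau * w in
  rows3 (row3 (d a b c) (o a b c) (o a c b))
        (row3 (o a b c) (d b c a) (o b c a))
        (row3 (o a c b) (o b c a) (d c a b)).

(** The three components are cyclic shifts of a single polynomial, so one computation with free
    indices serves them all. *)
Lemma tame_reduced_component (A : set 'rV[R]_3) (B : R) (i j k : 'I_3) :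
  (forall x, A x -> `|x| <= B) ->
  tame A (fun x => beta * x 0 i + xi * x 0 i ^+ 3 + eta * x 0 i * x 0 j ^+ 2
      + eta * x 0 i * x 0 k ^+ 2 + tau * x 0 j * x 0 k)
    (fun x h =>
      h 0 i * (beta + 3 * xi * x 0 i ^+ 2 + eta * x 0 j ^+ 2 + eta * x 0 k ^+ 2)
      + h 0 j * (2 * eta * x 0 i * x 0 j + tau * x 0 k)
      + h 0 k * (2 * eta * x 0 i * x 0 k + tau * x 0 j)).
Proof.
move=> AB; have X l := tame_coord A B l AB.
have M u v : tame A _ _ := tameM A _ _ _ _ (X u) (X v).
have M3 u v : tame A _ _ := tameM A _ _ _ _ (X u) (M v v).
have := tameD A _ _ _ _ (tameD A _ _ _ _ (tameD A _ _ _ _ (tameD A _ _ _ _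
  (tameZ A beta _ _ (X i)) (tameZ A xi _ _ (M3 i i))) (tameZ A eta _ _ (M3 i j)))
  (tameZ A eta _ _ (M3 i k))) (tameZ A tau _ _ (M j k)).
by apply: tame_ext => [x|x h]; ring.
Qed.

Lemma reduced_field_C11 (p : 'rV[R]_3) :
  exists2 C, 0 <= C & C11 (cball p 1) C F reduced_jacobian.
Proof.
apply: tame_C11 => j.
have AB x : cball p 1 x -> `|x| <= 1 + `|p|.
  by move=> xp; rewrite -[x](subrK p) (le_trans (ler_normD _ _))// lerD2r.
have T i k l := tame_reduced_component _ _ i k l AB.
case: j => -[|[|[|//]]] lj.
- rewrite (_ : Ordinal lj = 0); last exact/val_inj.
  apply: tame_ext (T 0 1 2) => [x|x h].
    by rewrite /F /reduced_field mxE/=; ring.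
  by rewrite mulmx_rows3 !mxE/=; ring.
- rewrite (_ : Ordinal lj = 1); last exact/val_inj.
  apply: tame_ext (T 1 2 0) => [x|x h].
    by rewrite /F /reduced_field mxE/=; ring.
  by rewrite mulmx_rows3 !mxE/=; ring.
- rewrite (_ : Ordinal lj = 2); last exact/val_inj.
  apply: tame_ext (T 2 0 1) => [x|x h].
    by rewrite /F /reduced_field mxE/=; ring.
  by rewrite mulmx_rows3 !mxE/=; ring.
Qed.

End reduced_system.

(** At a roll the two other coordinates are coupled by tau times the signed amplitude. The direction
    with the sign of the roll therefore has the larger transverse rate; it comes second, its
    opposite third, and [roll_rates] can be the same for all six rolls. *)
Definition roll_basis {R : realType} (s : bool) (j : 'I_3) : 'M[R]_3 :=
  rows3 (nth 0 [:: row3 1 0 0; row3 0 1 0; row3 0 0 1] j)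
    (roll_direction R s j) (roll_direction R (~~ s) j).

Lemma sign_negb {R : realType} (s : bool) : (-1) ^+ (~~ s) = - (-1) ^+ s :> R.
Proof. by case: s; rewrite ?expr0 ?expr1 ?opprK. Qed.

Lemma roll_basis_unit {R : realType} (s : bool) (j : 'I_3) :
  @roll_basis R s j \in unitmx.
Proof.
(* The vectors u, v, w are the rows of the explicit inverse; v takes the position of the radial
   coordinate. *)
pose e : R := (-1) ^+ s; have e2 : e * e = 1 by rewrite /e -expr2 sqrr_sign.
pose u : 'rV[R]_3 := row3 0 (e / 2) (- e / 2); pose w : 'rV[R]_3 := row3 0 (1 / 2) (1 / 2).
pose v : 'rV[R]_3 := row3 1 0 0.
apply: (proj1 (mulmx1_unit (B := nth 0 [:: rows3 v u w; rows3 u v w; rows3 u w v] j) _)).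
rewrite -rows3_1 /roll_basis /roll_direction sign_negb -/e.
by case: j => -[|[|[|//]]] ? /=; apply: rows3_mulmx;
  rewrite mulmx_rows3; apply: rV3P; rewrite !mxE/=; field: e2.
Qed.

Section roll_linearization.
Context {R : realType}.
Variables beta xi eta tau : R.
Hypotheses (beta_gt0 : 0 < beta) (xi_lt0 : xi < 0).

Let rho : R := Num.sqrt (- beta / xi).
Let sigma : R := Num.sqrt (- xi / beta).

(** Factoring out rho^2 and writing sigma for 1 / rho shows each transverse rate with the sign of
    eta minus one of the two thresholds. *)
Definition roll_rates : 'rV[R]_3 :=
  row3 (- 2 * beta) (rho ^+ 2 * (eta - (xi - tau * sigma)))
    (rho ^+ 2 * (eta - (xi + tau * sigma))).

Lemma roll_radius_gt0 : 0 < rho.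
Proof.
by rewrite sqrtr_gt0 nmulr_lgt0 ?invr_lt0 ?oppr_lt0.
Qed.

(** Oriented to eliminate [beta], so that the identities at a roll become polynomial in rho, with
    sigma rho = 1 and the squared sign as the only relations. *)
Lemma roll_radius_sqr : beta = - xi * rho ^+ 2.
Proof.
have xi0 := ltr0_neq0 xi_lt0.
rewrite sqr_sqrtr; last by have := roll_radius_gt0; rewrite sqrtr_gt0 => /ltW.
by field.
Qed.

Lemma roll_radius_inv : sigma * rho = 1.
Proof.
rewrite -sqrtrM; last by rewrite divr_ge0 ?oppr_ge0 ?ltW.
have -> : - xi / beta * (- beta / xi) = 1.
  by field; rewrite (lt0r_neq0 beta_gt0) (ltr0_neq0 xi_lt0).
exact: sqrtr1.
Qed.

Lemma roll_equilibrium s j :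
  reduced_field beta xi eta tau (roll beta xi s j) = 0.
Proof.
have b := roll_radius_sqr; have e2 := sqrr_sign R s.
rewrite /roll -/rho; move: e2; set e := (-1) ^+ s => e2.
have e3 : e ^+ 3 = e by rewrite exprS e2 mulr1.
have z : beta * (e * rho) + xi * (e * rho) ^+ 3 = 0.
  by rewrite exprMn e3 b; ring.
by case: j => -[|[|[|//]]] ? /=; apply: rV3P; rewrite /reduced_field !mxE/=;
  first [ring | rewrite -[RHS]z; ring].
Qed.

Lemma roll_basis_jacobian s j :
  roll_basis s j *m reduced_jacobian beta xi eta tau (roll beta xi s j) =
  diag_mx roll_rates *m roll_basis s j.
Proof.
have b := roll_radius_sqr; have e2 := sqrr_sign R s; have sr := roll_radius_inv.
rewrite diag_mx_rows3 /roll_basis /roll_direction sign_negb /roll -/rho.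
move: e2; set e := (-1) ^+ s => e2.
case: j => -[|[|[|//]]] ? /=; apply: rows3_mulmx; rewrite mulmx_rows3;
  apply: rV3P; rewrite !mxE/=.
all: rewrite ?b; ring: e2 sr.
Qed.

End roll_linearization.

Lemma normsq_gt0 {R : realType} {n : nat} (k : 'rV[R]_n) : k != 0 -> 0 < normsq k.
Proof.
move=> k0; rewrite lt_def /normsq /dot mxE; apply/andP; split.
  apply: contra k0 => /eqP k20; apply/eqP/rowP => i; rewrite mxE; apply/eqP.
  move: k20 => /psumr_eq0P/(_ i isT) h.
  rewrite -sqrf_eq0 expr2; apply/eqP.
  by rewrite -{2}[k]trmxK [k^T^T _ _]mxE h// => l _; rewrite mxE -expr2 sqr_ge0.
by apply: sumr_ge0 => l _; rewrite mxE -expr2 sqr_ge0.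
Qed.

Theorem theorem8p2 (R : realType) (B : 'M[R]_2) (k1 k2 k3 : 'rV[R]_2)
    (lambda gamma2 gamma3 : R) :
  let beta := coef_beta k1 lambda in
  let xi := coef_xi k1 gamma2 gamma3 in
  let eta := coef_eta k1 k2 gamma2 gamma3 in
  let tau := coef_tau k1 gamma2 in
  let F := reduced_field beta xi eta tau in
  let p := roll beta xi in
  B \in unitmx ->
  k3 = k1 + k2 ->
  minimal_vectors (dual_lattice (lattice B)) =
    [set k | k \in [:: k1; - k1; k2; - k2; k3; - k3]] ->
  gamma2 < 0 ->
  0 < gamma3 ->
  0 < beta ->
  xi < 0 ->
  [/\ eta < xi - tau * Num.sqrt (- xi / beta) ->
        forall (s : bool) (j : 'I_3),
          eigenvalue_counts F (p s j) 3 0 /\ local_attractor F (p s j),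
      xi - tau * Num.sqrt (- xi / beta) < eta <
          xi + tau * Num.sqrt (- xi / beta) ->
        forall (s : bool) (j : 'I_3),
          [/\ eigenvalue_counts F (p s j) 2 1,
              forall v : 'rV[R]_3, unstable_direction F (p s j) v <->
                exists2 c : R, c != 0 & v = c *: roll_direction R s j &
              saddle F (p s j) 2 1] &
      xi + tau * Num.sqrt (- xi / beta) < eta ->
        forall (s : bool) (j : 'I_3),
          eigenvalue_counts F (p s j) 1 2 /\ saddle F (p s j) 1 2].
Proof.
move=> beta xi eta tau F p _ _ minE gamma20 _ beta0 xi0.
have k1_gt0 : 0 < normsq k1.
  apply: normsq_gt0.
  (* A minimal vector is nonzero, hence |k1|^2 > 0; together with gamma2 < 0 this makes tau positive
     and orders the two thresholds. *)
  have : minimal_vectors (dual_lattice (lattice B)) k1 by rewrite minE /= mem_head.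
  by case.
have tau0 : 0 < tau by rewrite /tau /coef_tau mulNr -mulrN mulr_gt0// oppr_gt0.
pose rho := Num.sqrt (- beta / xi); pose sigma := Num.sqrt (- xi / beta).
have rho0 : 0 < rho ^+ 2 by rewrite exprn_gt0// roll_radius_gt0.
have sigma0 : 0 < sigma by rewrite sqrtr_gt0 divr_gt0// oppr_gt0.
have ts0 : 0 < tau * sigma by rewrite mulr_gt0.
rewrite -/sigma.
pose mu := roll_rates beta xi eta tau.
have [mu_0 mu_1 mu_2] : [/\ mu 0 0 = - 2 * beta,
    mu 0 1 = rho ^+ 2 * (eta - (xi - tau * sigma)) &
    mu 0 2 = rho ^+ 2 * (eta - (xi + tau * sigma))] by exact: row3E.
(* Each sign is stored as a pair of boolean facts, which serve as rewrite rules when the stable and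
   unstable indices are counted. *)
have mu0n : (mu 0 0 < 0) * ((0 < mu 0 0) = false).
  have h : mu 0 0 < 0 by rewrite mu_0; lra.
  by split => //; rewrite ltNge ltW.
have mu1n : eta < xi - tau * sigma -> (mu 0 1 < 0) * ((0 < mu 0 1) = false).
  move=> h; have h' : mu 0 1 < 0 by rewrite mu_1 pmulr_rlt0// subr_lt0.
  by split => //; rewrite ltNge ltW.
have mu1p : xi - tau * sigma < eta -> ((mu 0 1 < 0) = false) * (0 < mu 0 1).
  move=> h; have h' : 0 < mu 0 1 by rewrite mu_1 pmulr_rgt0// subr_gt0.
  by split => //; rewrite ltNge ltW.
have mu2n : eta < xi + tau * sigma -> (mu 0 2 < 0) * ((0 < mu 0 2) = false).
  move=> h; have h' : mu 0 2 < 0 by rewrite mu_2 pmulr_rlt0// subr_lt0.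
  by split => //; rewrite ltNge ltW.
have mu2p : xi + tau * sigma < eta -> ((mu 0 2 < 0) = false) * (0 < mu 0 2).
  move=> h; have h' : 0 < mu 0 2 by rewrite mu_2 pmulr_rgt0// subr_gt0.
  by split => //; rewrite ltNge ltW.
have ord3 (P : 'I_3 -> Prop) : P 0 -> P 1 -> P 2 -> forall i, P i.
  by move=> P0 P1 P2 [[|[|[|//]]] l];
    [move: P0|move: P1|move: P2]; congr P; exact/val_inj.
have mu_neq0 : mu 0 1 != 0 -> mu 0 2 != 0 -> forall i, mu 0 i != 0.
  by move=> h1 h2; apply: ord3 => //; rewrite lt_eqF ?mu0n.
have eqF s j : F (p s j) = 0 by exact: roll_equilibrium.
have PJ s j := roll_basis_jacobian beta xi eta tau beta0 xi0 s j.
have Pu s j := @roll_basis_unit R s j.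
have FJ s j := reduced_field_C11 beta xi eta tau (p s j).
split=> [h s j|/andP[h1 h2] s j|h s j]; have [C C0 {}FJ] := FJ s j.
- have h1 := mu1n h; have h2 := mu2n ltac:(lra).
  have mun : forall i, mu 0 i < 0 by apply: ord3; rewrite ?mu0n ?h1 ?h2.
  have mu0 i : mu 0 i != 0 by rewrite lt_eqF.
  split; last exact: hyperbolic_local_attractor FJ (eqF s j) (Pu s j) (PJ s j) mu0 mun.
  have := hyperbolic_eigenvalue_counts _ _ _ _ _ _ _ ltr01 FJ (Pu s j) (PJ s j).
  by rewrite !card_ord3/= !(mu0n, h1, h2).
- have {}h1 := mu1p h1; have {}h2 := mu2n h2.
  have mu0 : forall i, mu 0 i != 0.
    by apply: mu_neq0; [rewrite gt_eqF ?h1|rewrite lt_eqF ?h2].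
  have cs : #|[pred i | mu 0 i < 0]| = 2%N by rewrite card_ord3/= !(mu0n, h1, h2).
  have cu : #|[pred i | 0 < mu 0 i]| = 1%N by rewrite card_ord3/= !(mu0n, h1, h2).
  have ev : eigenvalue_counts F (p s j) 2 1.
    have := hyperbolic_eigenvalue_counts _ _ _ _ _ _ _ ltr01 FJ (Pu s j) (PJ s j).
    by rewrite cs cu.
  split=> //.
    (* Row 1 belongs to the lower threshold xi - tau sigma, the only one that eta exceeds in this
       case. *)
    move=> v; have dirE : roll_direction R s j = row 1 (roll_basis s j) by rewrite rowK.
    rewrite dirE; apply: (hyperbolic_unstable_direction _ _ _ _ _ _ mu) ltr01 FJ (Pu s j) (PJ s j) _ _.
      by rewrite h1.
    by apply: ord3; rewrite ?eqxx ?mu0n ?h2.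
  split=> //; split=> //.
    exact: hyperbolic_stable_manifold ltr01 C0 FJ (eqF s j) (Pu s j) (PJ s j) mu0 _ cs.
  exact: hyperbolic_unstable_manifold ltr01 C0 FJ (eqF s j) (Pu s j) (PJ s j) mu0 cu.
- have h1 := mu1p ltac:(lra); have {h}h2 := mu2p h.
  have mu0 : forall i, mu 0 i != 0.
    by apply: mu_neq0; rewrite gt_eqF ?h1 ?h2.
  have cs : #|[pred i | mu 0 i < 0]| = 1%N by rewrite card_ord3/= !(mu0n, h1, h2).
  have cu : #|[pred i | 0 < mu 0 i]| = 2%N by rewrite card_ord3/= !(mu0n, h1, h2).
  have ev : eigenvalue_counts F (p s j) 1 2.
    have := hyperbolic_eigenvalue_counts _ _ _ _ _ _ _ ltr01 FJ (Pu s j) (PJ s j).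
    by rewrite cs cu.
  split=> //; split=> //; split=> //.
    exact: hyperbolic_stable_manifold ltr01 C0 FJ (eqF s j) (Pu s j) (PJ s j) mu0 _ cs.
  exact: hyperbolic_unstable_manifold ltr01 C0 FJ (eqF s j) (Pu s j) (PJ s j) mu0 cu.
Qed.
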